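(* Let $\lambda_0>0$ and let $r_0,k_0\in\mathbb{R}$ with $k_0^2\ne 1+r_0-2r_0^2$. Suppose $(S,\omega)$, with $S\in C^1([0,T_{max});\mathcal{S}^{3\times3})$, $\operatorname{tr}(S)=0$, $\omega\in C^1([0,T_{max});\mathbb{R}^3)$, is a solution of the strain-vorticity pair equation with initial data $$S^0=\begin{pmatrix}-(r_0+1)\lambda_0&0&0\\0&r_0\lambda_0&0\\0&0&\lambda_0\end{pmatrix},\qquad \omega^0=\begin{pmatrix}0\\2k_0\lambda_0\\0\end{pmatrix}.$$ Then $(S,\omega)$ is the solution of the strain-vorticity pair equation with initial data $S^0,\omega^0$ given on $[0,T_{max})$ by $$S(t)=\begin{pmatrix}-(r(t)+1)\lambda(t)&0&0\\0&r(t)\lambda(t)&0\\0&0&\lambda(t)\end{pmatrix},\qquad \omega(t)=\begin{pmatrix}0\\2k(t)\lambda(t)\\0\end{pmatrix},$$ where $r,k,\lambda\in C^1([0,T_{max}))$, with $r(0)=r_0$, $k(0)=k_0$, $\lambda(0)=\lambda_0$, satisfy $$\partial_t\lambda=\tfrac13\left(-1+2r+2r^2+k^2\right)\lambda^2,$$ $$\partial_t r=\tfrac13\lambda\left(2+3r-3r^2-2r^3-(r+2)k^2\right),$$ $$\partial_t k=\tfrac13\lambda\left(1+r-2r^2-k^2\right)k.$$ For all $r_0\neq-2$ let $m_0=\frac{k_0}{r_0+2}$, and if $-\frac12<m_0<\frac12$ let $$r_\infty=\frac{1-4m_0^2+3\sqrt{1-4m_0^2}}{2m_0^2+4},\qquad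 k_\infty=m_0\left(\frac{9+3\sqrt{1-4m_0^2}}{2m_0^2+4}\right).$$ Let $g(t)=1+r(t)-2r(t)^2-k(t)^2$. Then the following hold. 1. If $r_0>0$ and $1+r_0-2r_0^2<k_0^2<\frac14(r_0+2)^2$, then $T_{max}<+\infty$ and $\lim_{t\to T_{max}}r(t)=r_\infty$, $\lim_{t\to T_{max}}k(t)=k_\infty$, $\lim_{t\to T_{max}}g(t)=0$, $\lim_{t\to T_{max}}\lambda(t)=+\infty$. 2. If $-\frac12<r_0<1$ and $k_0^2<1+r_0-2r_0^2$, then $T_{max}<+\infty$ and $\lim_{t\to T_{max}}r(t)=r_\infty$, $\lim_{t\to T_{max}}k(t)=k_\infty$, $\lim_{t\to T_{max}}g(t)=0$, $\lim_{t\to T_{max}}\lambda(t)=+\infty$. 3. If $r_0>0$ and $k_0^2=\frac14(r_0+2)^2$, then $T_{max}=+\infty$ and $\lim_{t\to+\infty}r(t)=0$, $\lim_{t\to+\infty}k(t)=1$, $\lim_{t\to+\infty}g(t)=0$. There is, however, blowup at infinity, with $\lim_{t\to+\infty}\lambda(t)=+\infty$. 4. If $r_0>0$ and $k_0^2>\frac14(r_0+2)^2$, then $T_{max}<+\infty$ and $\lim_{t\to T_{max}}r(t)=-2$, $\lim_{t\to T_{max}}k(t)=0$, $\lim_{t\to T_{max}}\lambda(t)=+\infty$. 5. If $-\frac12\le r_0\le0$ and $k_0^2>1+r_0-2r_0^2$, then $T_{max}<+\infty$ and $\lim_{t\to T_{max}}r(t)=-2$, $\lim_{t\to T_{max}}k(t)=0$,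 $\lim_{t\to T_{max}}\lambda(t)=+\infty$. 6. If $r_0<-\frac12$, then $T_{max}<+\infty$ and $\lim_{t\to T_{max}}r(t)=-2$, $\lim_{t\to T_{max}}k(t)=0$, $\lim_{t\to T_{max}}\lambda(t)=+\infty$.
   Context: Strain-vorticity pair equation: for $S\in C^1([0,T_{max});\mathcal{S}^{3\times3})$ (symmetric real $3\times 3$ matrices) with $\operatorname{tr}(S)=0$ and $\omega\in C^1([0,T_{max});\mathbb{R}^3)$, $$\partial_t S+S^2-\tfrac13|S|^2I_3+\tfrac14\omega\otimes\omega-\tfrac1{12}|\omega|^2I_3=0,\qquad \partial_t\omega-S\omega=0,$$ where $I_3$ is the $3\times3$ identity matrix, $|S|^2=\sum_{i,j}S_{ij}^2$ and $(\omega\otimes\omega)_{ij}=\omega_i\omega_j$. $T_{max}\in(0,+\infty]$ denotes the maximal time of existence of the solution.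
   Formalization: In item 3 the limit of k(t) is the sign of k_0 (1 if k_0>0, −1 if k_0<0) instead of 1, since k/(r+2) is conserved and the stated limit 1 fails for k_0<0. *)

(* Defs.v *)
From HB Require Import structures.
From mathcomp Require Import all_boot all_order all_algebra.
From mathcomp Require Import all_classical all_reals all_analysis.
Set Implicit Arguments.
Unset Strict Implicit.
Unset Printing Implicit Defensive.
Import Order.TTheory GRing.Theory Num.Theory.
Import numFieldNormedType.Exports.
Local Open Scope classical_set_scope.
Local Open Scope ring_scope.

(* The half-open interval [0, T), where T may be +oo. *)
Definition time_interval (R : realType) (T : \bar R) : set R :=
  [set t : R | 0 <= t /\ (t%:E < T)%E].

(* Same difference quotient as in derive1, but restricted to increments that
   stay inside I, so that the derivative is one-sided at an endpoint of I. *)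
Definition diff_quot (R : realType) (V : normedModType R) (I : set R)
    (f : R -> V) (t : R) : set_system V :=
  (h^-1 *: (f (h + t) - f t)) @[h --> within [set h : R | I (h + t)] 0^'].

Definition deriv_in (R : realType) (V : normedModType R) (I : set R)
    (f : R -> V) (t : R) : V := lim (diff_quot I f t).

Definition C1_in (R : realType) (V : normedModType R) (I : set R)
    (f : R -> V) : Prop :=
  (forall t, I t -> cvg (diff_quot I f t)) /\
  {within I, continuous (deriv_in I f)}.

(* |A|^2 for a matrix or a column vector (Frobenius, resp. Euclidean); the norm
   `|A| of MathComp-Analysis is the sup norm. *)
Definition sqnorm (R : realType) (m n : nat) (A : 'M[R]_(m, n)) : R :=
  \sum_(i < m) \sum_(j < n) A i j ^+ 2.

(* w *m w^T is the tensor product of w with itself. *)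
Record sv_solution (R : realType) (T : \bar R)
    (S : R -> 'M[R]_3) (w : R -> 'cV[R]_3) : Prop := SvSolution {
  sv_T_gt0 : (0%:E < T)%E ;
  sv_S_C1 : C1_in (time_interval T) S ;
  sv_w_C1 : C1_in (time_interval T) w ;
  sv_S_sym : forall t, time_interval T t -> (S t)^T = S t ;
  sv_S_tr : forall t, time_interval T t -> \tr (S t) = 0 ;
  sv_strain : forall t, time_interval T t ->
    deriv_in (time_interval T) S t + S t *m S t
      - (3^-1 * sqnorm (S t)) *: 1%:M + 4^-1 *: (w t *m (w t)^T)
      - (12^-1 * sqnorm (w t)) *: 1%:M = 0 ;
  sv_vorticity : forall t, time_interval T t ->
    deriv_in (time_interval T) w t - S t *m w t = 0
}.

(* (S, w) solves the equation on [0, T) and has no extension beyond T. *)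
Definition sv_maximal_solution (R : realType) (T : \bar R)
    (S : R -> 'M[R]_3) (w : R -> 'cV[R]_3) : Prop :=
  sv_solution T S w /\
  forall (T' : \bar R) (S' : R -> 'M[R]_3) (w' : R -> 'cV[R]_3),
    sv_solution T' S' w' ->
    (forall t, time_interval T t -> S' t = S t /\ w' t = w t) ->
    (T' <= T)%E.

Definition strain_of (R : realType) (r l : R) : 'M[R]_3 :=
  diag_mx (\row_(j < 3) [:: - (r + 1) * l; r * l; l]`_j).

Definition vorticity_of (R : realType) (k l : R) : 'cV[R]_3 :=
  \col_(i < 3) [:: 0; 2 * k * l; 0]`_i.

Definition r_infty (R : realType) (m : R) : R :=
  (1 - 4 * m ^+ 2 + 3 * Num.sqrt (1 - 4 * m ^+ 2)) / (2 * m ^+ 2 + 4).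

Definition k_infty (R : realType) (m : R) : R :=
  m * ((9 + 3 * Num.sqrt (1 - 4 * m ^+ 2)) / (2 * m ^+ 2 + 4)).

(* Main.v *)
Require Import Defs.
From HB Require Import structures.
From mathcomp Require Import all_boot all_order all_algebra.
From mathcomp Require Import all_classical all_reals all_analysis.
From mathcomp Require Import ring lra.
Set Implicit Arguments.
Unset Strict Implicit.
Unset Printing Implicit Defensive.
Import Order.TTheory GRing.Theory Num.Theory.
Import numFieldNormedType.Exports.
Local Open Scope classical_set_scope.
Local Open Scope ring_scope.

(** Each reflection in a coordinate plane containing the axis of the initial
    vorticity fixes the initial data, so by uniqueness it fixes the solution:
    the strain stays diagonal and the vorticity keeps its direction. Uniqueness
    is Gronwall's inequality applied to the squared distance of two solutions
    ([ode_uniqueness], [sv_flow_diagonal]).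

    Let [b] be the strain eigenvalue along the vorticity, [p] the third minus the
    first eigenvalue and [u] the component of the vorticity. Then [p' = b p],
    [u' = b u] and [b' = - b^2 / 2 + (p^2 - u^2) / 6]. The quantity
    [Q = p^2 - u^2 - 9 b^2], which is [4 g l^2] in terms of the third eigenvalue
    [l], satisfies [Q' = - b Q]. So [p], [u] and [1 / Q] are all stretched by the
    same positive factor; writing it as [y^2] and putting [v = b y] gives
    [y' = v / 2] and [v' = E y^5 / 6], with the energy integral
    [9 v^2 = E y^6 - q], where [E] and [q] are the initial values of
    [p^2 - u^2] and of [Q] ([reduced_flow_amplitude]). The invariance of
    [k / (r + 2)], which is half of [u / p], is contained in the common
    stretching of [u] and [p]. The six cases become three regimes of this one-dimensional motion.

    Growth (the first two cases): [E > 0] and [v] is or becomes positive; then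
    [v >= c y^3], so [y] reaches infinity in finite time, and by the energy
    integral [v / y^3] tends to [sqrt E / 3], which determines the limits of [r]
    and [k] ([amplitude_growth], [growth_limits]).

    Collapse (the last three cases): [q < 0] and [v] is or becomes negative; then
    [v <= - c], so [y] reaches zero in finite time, [b = v / y] tends to minus
    infinity and dominates [p] and [u] ([amplitude_collapse],
    [collapse_limits]).

    Borderline (the third case): [E = 0], [v] is constant and [y] is affine, which gives
    an explicit solution for all times ([borderline_regime]).

    That [y] really runs to infinity or to zero at the maximal time requires a
    continuation principle: otherwise the solution would stay bounded, and it
    could be prolonged by a local solution whose time of existence depends only
    on a bound on the data. Such a local solution is a power series, the equation
    being quadratic ([local_existence], [amplitude_unbounded]). *)

(** * Derivatives of real functions, pointwise *)

Section PointwiseDerivative.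
Variable R : realType.
Implicit Types (f g : R -> R) (t a b : R).

Lemma is_derive_addf f g t a b : is_derive t 1 f a -> is_derive t 1 g b ->
  is_derive t 1 (fun s => f s + g s) (a + b).
Proof. exact: is_deriveD. Qed.

Lemma is_derive_oppf f t a : is_derive t 1 f a ->
  is_derive t 1 (fun s => - f s) (- a).
Proof. exact: is_deriveN. Qed.

Lemma is_derive_mulf f g t a b : is_derive t 1 f a -> is_derive t 1 g b ->
  is_derive t 1 (fun s => f s * g s) (a * g t + f t * b).
Proof.
move=> fa gb; have := is_deriveM fa gb.
by rewrite /GRing.scale /= addrC (mulrC _ a).
Qed.

Lemma is_derive_expf f n t a : is_derive t 1 f a ->
  is_derive t 1 (fun s => f s ^+ n) (n%:R * f t ^+ n.-1 * a).
Proof.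
move=> fa; have := is_deriveX n fa; rewrite /GRing.scale /=.
by congr is_derive; apply/funext => s; rewrite fctE.
Qed.

Lemma is_derive_cstf (c : R) t : is_derive t 1 (fun=> c) 0.
Proof. exact: is_derive_cst. Qed.

Lemma is_derive_idf t : is_derive t 1 (fun s => s) 1.
Proof. exact: is_derive_id. Qed.

Lemma is_derive_invf f t a : f t != 0 -> is_derive t 1 f a ->
  is_derive t 1 (fun s => (f s)^-1) (- (f t ^+ 2)^-1 * a).
Proof. by move=> ft0 fa; exact: is_deriveV. Qed.

Lemma is_derive_sqrtf f t a : 0 < f t -> is_derive t 1 f a ->
  is_derive t 1 (fun s => Num.sqrt (f s)) ((2 * Num.sqrt (f t))^-1 * a).
Proof. by move=> ft0 fa; apply: is_derive1_comp; exact: is_derive1_sqrt. Qed.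

Lemma is_derive_expRf f t a : is_derive t 1 f a ->
  is_derive t 1 (fun s => expR (f s)) (expR (f t) * a).
Proof. by move=> fa; apply: is_derive1_comp; exact: is_derive_expR. Qed.

Lemma is_derive_sumf (J : Type) (s : seq J) (f : J -> R -> R) (d : J -> R) t :
  (forall j, is_derive t 1 (f j) (d j)) ->
  is_derive t 1 (fun u => \sum_(j <- s) f j u) (\sum_(j <- s) d j).
Proof.
move=> fd; elim: s => [|j s IH].
  rewrite big_nil (_ : (fun u => _) = fun=> 0); first exact: is_derive_cst.
  by apply/funext => u; rewrite big_nil.
rewrite big_cons (_ : (fun u => _) = fun u => f j u + \sum_(i <- s) f i u).
  exact: is_derive_addf.
by apply/funext => u; rewrite big_cons.
Qed.

Lemma is_derive_continuousf f t a : is_derive t 1 f a -> {for t, continuous f}.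
Proof.
by move=> [/derivable1_diffP /differentiable_continuous].
Qed.

Lemma is_derive_shiftf f (c t a : R) : is_derive (t - c) 1 f a ->
  is_derive t 1 (fun s => f (s - c)) a.
Proof.
move=> fa; have -> : a = a * 1 by rewrite mulr1.
have sc : is_derive t 1 (fun s => s - c) 1.
  have := is_derive_addf (is_derive_idf t) (is_derive_cstf (- c) t).
  by rewrite addr0.
exact: (@is_derive1_comp _ f (fun s => s - c)).
Qed.

End PointwiseDerivative.

(* Differentiates an expression built from functions whose derivatives are in
   the context, and leaves the equality between the two derivatives. The rules
   are applied without instance resolution, which would pick other forms of the
   derivative. *)
Ltac derive_pointwise :=
  notypeclasses refine (is_derive_eq _ _);
  [ repeat (first
    [ eassumption
    | notypeclasses refine (is_derive_cstf _ _)
    | notypeclasses refine (is_derive_idf _)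
    | notypeclasses refine (is_derive_addf _ _)
    | notypeclasses refine (is_derive_oppf _)
    | notypeclasses refine (is_derive_expf _ _)
    | notypeclasses refine (is_derive_mulf _ _) ])
  | cbn -[GRing.exp GRing.mul GRing.add GRing.opp GRing.one GRing.zero
          GRing.natmul] ].

Section MonotonicityFromDerivative.
Variable R : realType.
Implicit Types (f df : R -> R) (a b : R).

Lemma is_derive_within_continuous f df a b :
  (forall t, a <= t <= b -> is_derive t 1 f (df t)) ->
  {within `[a, b], continuous f}.
Proof.
move=> fdf; apply: derivable_within_continuous => t.
by rewrite in_itv /= => /fdf[].
Qed.

Lemma is_derive_ge0_le f df a b : a <= b ->
  (forall t, a <= t <= b -> is_derive t 1 f (df t)) ->
  (forall t, a < t < b -> 0 <= df t) -> f a <= f b.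
Proof.
move=> ab fdf df0.
have [->//|anb] := eqVneq a b.
have {anb}ab : a < b by rewrite lt_neqAle anb ab.
have [||c] := @MVT R f df a b ab.
- by move=> t; rewrite in_itv /= => /andP[at_ tb]; apply: fdf; rewrite !ltW.
- exact: is_derive_within_continuous fdf.
rewrite in_itv /= => cab fab; rewrite -subr_ge0 fab mulr_ge0 ?df0// subr_ge0.
exact: ltW.
Qed.

Lemma is_derive_le0_ge f df a b : a <= b ->
  (forall t, a <= t <= b -> is_derive t 1 f (df t)) ->
  (forall t, a < t < b -> df t <= 0) -> f b <= f a.
Proof.
move=> ab fdf df0; rewrite -lerN2.
apply: (@is_derive_ge0_le (fun t => - f t) (fun t => - df t)) => // t tab.
  by apply: is_derive_oppf; exact: fdf.
by rewrite oppr_ge0 df0.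
Qed.

Lemma is_derive_0_eq f a b : a <= b ->
  (forall t, a <= t <= b -> is_derive t 1 f 0) -> f a = f b.
Proof.
move=> ab fdf; apply/eqP; rewrite eq_le; apply/andP; split.
  exact: (@is_derive_ge0_le f (fun=> 0)).
exact: (@is_derive_le0_ge f (fun=> 0)).
Qed.

(** Monotonicity of the difference with a linear function. *)
Lemma is_derive_ge_growth f df (c a b : R) : a <= b ->
  (forall t, a <= t <= b -> is_derive t 1 f (df t)) ->
  (forall t, a < t < b -> c <= df t) -> f a + c * (b - a) <= f b.
Proof.
move=> ab fdf dfc.
have : f a - c * a <= f b - c * b.
  apply: (@is_derive_ge0_le (fun t => f t - c * t) (fun t => df t - c)) => //.
    by move=> t /fdf fd; derive_pointwise; ring.
  by move=> t /dfc; rewrite subr_ge0.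
by lra.
Qed.

Lemma is_derive_le_growth f df (c a b : R) : a <= b ->
  (forall t, a <= t <= b -> is_derive t 1 f (df t)) ->
  (forall t, a < t < b -> df t <= c) -> f b <= f a + c * (b - a).
Proof.
move=> ab fdf dfc.
have : f b - c * b <= f a - c * a.
  apply: (@is_derive_le0_ge (fun t => f t - c * t) (fun t => df t - c)) => //.
    by move=> t /fdf fd; derive_pointwise; ring.
  by move=> t /dfc; rewrite subr_le0.
by lra.
Qed.

Lemma is_derive_bounded f df a b :
  (forall t, a <= t <= b -> is_derive t 1 f (df t)) ->
  exists M, 0 <= M /\ forall t, a <= t <= b -> `|f t| <= M.
Proof.
move=> fdf; have [ab|ba] := leP a b; last first.
  by exists 0; split=> // t /andP[at_ tb]; have := le_trans at_ tb; rewrite leNgt ba.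
have cf := is_derive_within_continuous fdf.
have [c _ fc] := EVT_max ab cf; have [d _ fd] := EVT_min ab cf.
exists (`|f c| + `|f d|); split=> [|t tab]; first by rewrite addr_ge0.
have tI : t \in `[a, b] by rewrite in_itv.
rewrite ler_norml; apply/andP; split.
  have := fd _ tI; have := ler_norm (- f d); rewrite normrN.
  by have := normr_ge0 (f c); lra.
have := fc _ tI; have := ler_norm (f c).
by have := normr_ge0 (f d); lra.
Qed.

(** The zero is the infimum of the times at which [f] is not positive. *)
Lemma first_zero f a b : a <= b ->
  (forall t, a <= t <= b -> {for t, continuous f}) ->
  0 < f a -> f b <= 0 ->
  exists z, [/\ a < z, z <= b, f z = 0 & forall t, a <= t < z -> 0 < f t].
Proof.
move=> ab cf fa fb.
pose Z := [set t | a <= t <= b /\ f t <= 0].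
have Zb : Z b by split=> //; rewrite ab lexx.
have hZ : has_inf Z by split; [exists b | exists a => t [/andP[]]].
have az : a <= inf Z by apply: lb_le_inf; [exists b | move=> t [/andP[]]].
have zb : inf Z <= b by apply: ge_inf => //; exact: hZ.2.
have czf : {for inf Z, continuous f} by apply: cf; rewrite az zb.
have pos t : a <= t < inf Z -> 0 < f t.
  move=> /andP[at_ tz]; rewrite ltNge; apply/negP => ft.
  suff : inf Z <= t by rewrite leNgt tz.
  by apply: ge_inf; [exact: hZ.2 | split=> //; rewrite at_ (le_trans (ltW tz))].
have fz_le0 : f (inf Z) <= 0.
  rewrite leNgt; apply/negP => fz0.
  have [/= e e0 eZ] := (cvgr_gt _ czf _ fz0 : nbhs (inf Z) _).
  have [t Zt te] := inf_adherent e0 hZ.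
  have [_ ft0] := Zt.
  suff : 0 < f t by rewrite ltNge ft0.
  apply: eZ; rewrite /ball_ /= distrC ger0_norm ?subr_ge0; last first.
    by apply: ge_inf => //; exact: hZ.2.
  by rewrite ltrBlDl.
have az' : a < inf Z.
  by rewrite lt_neqAle az andbT; apply/eqP => E; move: fz_le0; rewrite -E leNgt fa.
exists (inf Z); split=> //; apply/eqP; rewrite eq_le fz_le0 /= leNgt.
apply/negP => fz0.
have [/= e e0 eZ] := (cvgr_lt _ czf _ fz0 : nbhs (inf Z) _).
pose t := Num.max a (inf Z - e / 2).
have tz : t < inf Z by rewrite gt_max az' gtrBl divr_gt0.
have : 0 < f t by apply: pos; rewrite tz le_max lexx.
rewrite ltNge => /negP; apply; apply: ltW; apply: eZ.
rewrite /ball_ /= gtr0_norm ?subr_gt0// ltrBlDl -ltrBlDr.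
rewrite lt_max; apply/orP; right; lra.
Qed.

(** As long as [f] is positive, [f t * expR (K * t)] increases, where [K]
    bounds [h]: this excludes a first zero. *)
Lemma gronwall_gt0 f df (h : R -> R) (K a b : R) : a <= b ->
  (forall t, a <= t <= b -> is_derive t 1 f (df t)) ->
  (forall t, a <= t <= b -> `|h t| <= K) ->
  (forall t, a <= t <= b -> h t * f t <= df t) ->
  0 < f a -> 0 < f b.
Proof.
move=> ab fdf hK hf fa; rewrite ltNge; apply/negP => fb.
have [|z [az zb fz pos]] := first_zero ab _ fa fb.
  by move=> t /fdf; exact: is_derive_continuousf.
have : f a * expR (K * a) <= f z * expR (K * z).
  apply: (@is_derive_ge0_le (fun t => f t * expR (K * t))
    (fun t => (df t + K * f t) * expR (K * t))).
  - exact: ltW.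
  - move=> t /andP[at_ tz].
    have ftd : is_derive t 1 f (df t) by apply: fdf; rewrite at_ (le_trans tz).
    have etd : is_derive t 1 (fun s => expR (K * s)) (expR (K * t) * K).
      by apply: is_derive_expRf; derive_pointwise; ring.
    by derive_pointwise; ring.
  - move=> t /andP[at_ tz]; rewrite mulr_ge0 ?expR_ge0//.
    have tab : a <= t <= b by rewrite (ltW at_) (le_trans (ltW tz)).
    have ft0 : 0 < f t by apply: pos; rewrite (ltW at_).
    have := hf _ tab; have := hK _ tab; rewrite ler_norml => /andP[h1 _] h2.
    have : 0 <= (h t + K) * f t by rewrite mulr_ge0 ?(ltW ft0)//; lra.
    by lra.
by rewrite fz mul0r leNgt mulr_gt0 ?expR_gt0.
Qed.

(** The function [f t * expR (- K * t)] is nonincreasing. *)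
Lemma gronwall_le0 f df (K a b : R) : a <= b ->
  (forall t, a <= t <= b -> is_derive t 1 f (df t)) ->
  (forall t, a <= t <= b -> df t <= K * f t) ->
  f a <= 0 -> f b <= 0.
Proof.
move=> ab fdf dfK fa.
have : f b * expR (- K * b) <= f a * expR (- K * a).
  apply: (@is_derive_le0_ge (fun t => f t * expR (- K * t))
    (fun t => (df t - K * f t) * expR (- K * t))) => // t.
    move=> /fdf ftd.
    have etd : is_derive t 1 (fun s => expR (- K * s)) (expR (- K * t) * - K).
      by apply: is_derive_expRf; derive_pointwise; ring.
    by derive_pointwise; ring.
  move=> /andP[at_ tb]; rewrite mulr_le0_ge0 ?expR_ge0// subr_le0 dfK//.
  by rewrite !ltW.
move=> fab; rewrite -(pmulr_lle0 _ (expR_gt0 (- K * b))).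
by apply: le_trans fab _; rewrite mulr_le0_ge0 ?expR_ge0.
Qed.

End MonotonicityFromDerivative.

(** * One-sided differentiability on a half-open interval *)

Section OneSidedDerivative.
Variable R : realType.
Variable T : \bar R.
Local Notation I := (time_interval T).

Lemma time_interval0 : (0 < T)%E -> I 0.
Proof. by split. Qed.

Lemma time_interval_le (s t : R) : I t -> 0 <= s -> s <= t -> I s.
Proof.
by move=> [_ tT] s0 st; split=> //; apply: le_lt_trans tT; rewrite lee_fin.
Qed.

Lemma time_interval_room (t : R) : I t -> exists2 e, 0 < e & I (t + e).
Proof.
move=> [t0]; case: T => [T'| |//].
- rewrite lte_fin => tT; exists ((T' - t) / 2); first by rewrite divr_gt0// subr_gt0.
  split; last by rewrite lte_fin; lra.
  by rewrite addr_ge0// divr_ge0// subr_ge0 ltW.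
- by move=> _; exists 1 => //; split; rewrite ?ltry// addr_ge0.
Qed.

Lemma is_derive_cvg (V : normedModType R) (f : R -> V) (t : R) (d : V) :
  is_derive t 1 f d <-> h^-1 *: (f (h + t) - f t) @[h --> 0^'] --> d.
Proof.
have E : (fun h : R => h^-1 *: ((f \o shift t) (h *: (1 : R)) - f t)) =
         (fun h => h^-1 *: (f (h + t) - f t)).
  by apply/funext => h /=; rewrite /GRing.scale /= mulr1.
split=> [[df <-]|fd].
  by rewrite -E; exact: df.
split; first by rewrite /derivable E; apply/cvg_ex; exists d.
by rewrite /derive E; exact: cvg_lim.
Qed.

Lemma diff_quot_proper (t : R) : I t ->
  ProperFilter (within [set h : R | I (h + t)] 0^').
Proof.
move=> It; have [e e0 Ite] := time_interval_room It.
apply: Build_ProperFilter_ex => P; rewrite /within /= => nP.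
have [/= d d0 dP] : nbhs (0 : R) (fun h => h != 0 -> I (h + t) -> P h) by exact: nP.
pose h := Num.min (d / 2) e.
have h0 : 0 < h by rewrite lt_min e0 divr_gt0.
exists h; apply: dP; rewrite ?gt_eqF//.
- rewrite /ball_ /= sub0r normrN gtr0_norm// gt_min.
  by apply/orP; left; rewrite ltr_pdivrMr// mulr_natr mulr2n ltrDl.
- apply: (time_interval_le Ite); first by rewrite addr_ge0 ?(ltW h0)//; case: It.
  by rewrite addrC lerD2l ge_min lexx orbT.
Qed.

Lemma diff_quot_of_is_derive (V : normedModType R) (f F : R -> V) (t : R) (d : V) :
  I t -> (forall s, I s -> f s = F s) -> is_derive t 1 F d ->
  diff_quot I f t --> d.
Proof.
move=> It fF /is_derive_cvg Fd.
have : h^-1 *: (F (h + t) - F t) @[h --> within [set h : R | I (h + t)] 0^'] --> d.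
  exact: cvg_within_filter.
apply: cvg_trans; apply: near_eq_cvg.
by near=> h; rewrite !fF//; near: h; exact: withinT.
Unshelve. all: by end_near. Qed.

Lemma deriv_in_of_is_derive (V : normedModType R) (f F : R -> V) (t : R) (d : V) :
  I t -> (forall s, I s -> f s = F s) -> is_derive t 1 F d ->
  deriv_in I f t = d.
Proof.
move=> It fF Fd; have := diff_quot_proper It => PF.
exact: cvg_lim (diff_quot_of_is_derive It fF Fd).
Qed.

(** Passing to a function with a two-sided derivative turns all computations at
    the endpoint 0 into ordinary calculus. *)
Lemma C1_in_of_is_derive (V : normedModType R) (f F D : R -> V) :
  (forall s, I s -> f s = F s) ->
  (forall t, I t -> is_derive t 1 F (D t)) ->
  (forall t, I t -> {for t, continuous D}) ->
  C1_in I f /\ forall t, I t -> deriv_in I f t = D t.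
Proof.
move=> fF FD cD.
have fD t : I t -> deriv_in I f t = D t.
  by move=> It; exact: (deriv_in_of_is_derive It fF (FD t It)).
split=> //; split=> [t It|].
  by apply/cvg_ex; exists (D t); exact: (diff_quot_of_is_derive It fF (FD t It)).
apply: (@subspace_eq_continuous _ _ _ D).
  by move=> t; rewrite inE => /fD.
by apply: continuous_in_subspaceT => t; rewrite inE => /cD.
Qed.

(** Conversely, extend by the tangent line at 0 to the left of 0. *)
Lemma C1_in_extension (V : normedModType R) (f : R -> V) : C1_in I f ->
  exists F : R -> V, forall t, I t -> F t = f t /\ is_derive t 1 F (deriv_in I f t).
Proof.
move=> [cvf _].
pose F t := if t < 0 then f 0 + t *: deriv_in I f 0 else f t.
have Ff t : 0 <= t -> F t = f t by move=> t0; rewrite /F ltNge t0.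
exists F => t It; have t0 := It.1; split; first exact: Ff.
have [e e0 Ite] := time_interval_room It.
have ftd : diff_quot I f t --> deriv_in I f t by exact: cvf.
apply/is_derive_cvg.
have Iright : \forall h \near (0 : R)^'+, I (h + t).
  near=> h; apply: (time_interval_le Ite); first by rewrite addr_ge0.
  rewrite addrC lerD2l; near: h; exact: nbhs_right_le.
have cright : h^-1 *: (F (h + t) - F t) @[h --> 0^'+] --> deriv_in I f t.
  have : h^-1 *: (f (h + t) - f t) @[h --> 0^'+] --> deriv_in I f t.
    apply: cvg_trans ftd => P; rewrite /within /= => nP.
    have {}nP : \forall h \near (0 : R), h != 0 -> I (h + t) ->
      P (h^-1 *: (f (h + t) - f t)) by exact: nP.
    have {}nP : \forall h \near (0 : R)^'+, h != 0 -> I (h + t) ->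
      P (h^-1 *: (f (h + t) - f t)) by exact: cvg_within.
    move: nP Iright (nbhs_right_gt (0 : R)).
    by apply: filterS3 => h nPh Ih h0; apply: nPh => //; rewrite gt_eqF.
  apply: cvg_trans; apply: near_eq_cvg; near=> h.
  rewrite (Ff t)// Ff//; exact: addr_ge0.
suff cleft : h^-1 *: (F (h + t) - F t) @[h --> 0^'-] --> deriv_in I f t.
  move=> P lP.
  have hr : \forall h \near (0 : R), 0 < h -> P (h^-1 *: (F (h + t) - F t)).
    exact: (cright _ lP).
  have hl : \forall h \near (0 : R), h < 0 -> P (h^-1 *: (F (h + t) - F t)).
    exact: (cleft _ lP).
  have : \forall h \near (0 : R), h != 0 -> P (h^-1 *: (F (h + t) - F t)).
    move: hr hl; apply: filterS2 => h hr hl.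
    by rewrite neq_lt => /orP[/hl|/hr].
  by [].
have [t_eq0|t_neq0] := eqVneq t 0.
  rewrite t_eq0; apply: (@cvg_trans _ (deriv_in I f 0 @[h --> 0^'-])); last exact: cvg_cst.
  apply: near_eq_cvg; near=> h.
  have h0 : h < 0 by [].
  by rewrite addr0 (Ff 0)// /F h0 addrAC subrr add0r scalerA mulVf ?scale1r//.
have {t_neq0}t_gt0 : 0 < t by rewrite lt_neqAle eq_sym t_neq0.
have hleft : \forall h \near (0 : R)^'-, 0 <= h + t.
  near=> h; rewrite -lerBlDr sub0r; near: h; apply: nbhs_left_ge.
  by rewrite oppr_lt0.
have : h^-1 *: (f (h + t) - f t) @[h --> 0^'-] --> deriv_in I f t.
  apply: cvg_trans ftd => P; rewrite /within /= => nP.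
  have {}nP : \forall h \near (0 : R), h != 0 -> I (h + t) ->
    P (h^-1 *: (f (h + t) - f t)) by exact: nP.
  have {}nP : \forall h \near (0 : R)^'-, h != 0 -> I (h + t) ->
    P (h^-1 *: (f (h + t) - f t)) by exact: cvg_within.
  move: nP hleft (nbhs_left_lt (0 : R)).
  apply: filterS3 => h nPh ht h0; apply: nPh; first by rewrite lt_eqF.
  by apply: (time_interval_le It) => //; rewrite gerDr ltW.
apply: cvg_trans; apply: near_eq_cvg; near=> h.
by rewrite (Ff t)// Ff//; near: h.
Unshelve. all: by end_near. Qed.

End OneSidedDerivative.

Lemma is_derive_coord (R : realType) (m n : nat) (F : R -> 'M[R]_(m, n)) (t : R)
    (D : 'M[R]_(m, n)) i j :
  is_derive t 1 F D -> is_derive t 1 (fun s => F s i j) (D i j).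
Proof.
move=> /is_derive_cvg FD; apply/is_derive_cvg.
have := cvg_comp _ _ FD (@coord_continuous R m n i j D).
by apply: cvg_trans; apply: near_eq_cvg; near=> h; rewrite /= !mxE.
Unshelve. all: by end_near. Qed.

Lemma is_derive_matrix (R : realType) (m n : nat) (F : R -> 'M[R]_(m, n)) (t : R)
    (D : 'M[R]_(m, n)) :
  (forall i j, is_derive t 1 (fun s => F s i j) (D i j)) -> is_derive t 1 F D.
Proof.
move=> FD; apply/is_derive_cvg.
have -> : D = \sum_(i < m) \sum_(j < n) D i j *: delta_mx i j by exact: matrix_sum_delta.
have -> : (fun h => h^-1 *: (F (h + t) - F t)) = fun h => \sum_(i < m) \sum_(j < n)
    (h^-1 *: (F (h + t) i j - F t i j)) *: (delta_mx i j : 'M[R]_(m, n)).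
  apply/funext => h; rewrite [LHS]matrix_sum_delta.
  by apply: eq_bigr => i _; apply: eq_bigr => j _; rewrite !mxE.
apply: cvg_big => [|i _]; first exact: add_continuous.
apply: cvg_big => [|j _]; first exact: add_continuous.
apply: cvgZ; last exact: cvg_cst.
by have /is_derive_cvg := FD i j.
Qed.

(** * Uniqueness for locally Lipschitz systems *)

Section LocallyLipschitz.
Variables (R : realType) (J : finType).
Implicit Types (f g : (J -> R) -> R) (x y : J -> R).

Definition locally_lipschitz f := forall M : R, exists L, 0 <= L /\
  forall x y, (forall j, `|x j| <= M) -> (forall j, `|y j| <= M) ->
    `|f x - f y| <= L * \sum_j `|x j - y j|.

Let dist_ge0 x y : 0 <= \sum_j `|x j - y j|.
Proof. by apply: sumr_ge0. Qed.

Lemma locally_lipschitz_cst (c : R) : locally_lipschitz (fun=> c).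
Proof. by move=> M; exists 0; split=> // x y _ _; rewrite subrr normr0 mul0r. Qed.

Lemma locally_lipschitz_coord j : locally_lipschitz (fun x => x j).
Proof.
move=> M; exists 1; split=> // x y _ _; rewrite mul1r (bigD1 j)//= lerDl.
exact: sumr_ge0.
Qed.

Lemma locally_lipschitzD f g : locally_lipschitz f -> locally_lipschitz g ->
  locally_lipschitz (fun x => f x + g x).
Proof.
move=> lf lg M; have [L [L0 fL]] := lf M; have [K [K0 gK]] := lg M.
exists (L + K); split=> [|x y xM yM]; first exact: addr_ge0.
rewrite mulrDl (_ : _ - _ = (f x - f y) + (g x - g y)); last by ring.
by apply: le_trans (ler_normD _ _) _; apply: lerD; [exact: fL | exact: gK].
Qed.

Lemma locally_lipschitzM f g : locally_lipschitz f -> locally_lipschitz g ->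
  locally_lipschitz (fun x => f x * g x).
Proof.
have bounded h : locally_lipschitz h -> forall M, exists B, 0 <= B /\
    forall x, (forall j, `|x j| <= M) -> `|h x| <= B.
  move=> lh M; have [L [L0 hL]] := lh `|M|.
  exists (`|h (fun=> 0)| + L * \sum_(j : J) `|M|); split=> [|x xM].
    by rewrite addr_ge0// mulr_ge0// sumr_ge0.
  rewrite -[h x](subrK (h (fun=> 0))) addrC.
  apply: le_trans (ler_normD _ _) _; rewrite lerD2l.
  apply: le_trans (hL _ _ _ _) _.
  - by move=> j; exact: le_trans (xM j) (ler_norm _).
  - by move=> j; rewrite normr0.
  rewrite ler_wpM2l// ler_sum// => j _; rewrite subr0.
  exact: le_trans (xM j) (ler_norm _).
move=> lf lg M; have [L [L0 fL]] := lf M; have [K [K0 gK]] := lg M.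
have [A [A0 fA]] := bounded f lf M; have [B [B0 gB]] := bounded g lg M.
exists (A * K + B * L); split=> [|x y xM yM]; first by rewrite addr_ge0// mulr_ge0.
rewrite (_ : _ - _ = f x * (g x - g y) + g y * (f x - f y)); last by ring.
apply: le_trans (ler_normD _ _) _; rewrite mulrDl !normrM -!mulrA.
by apply: lerD; apply: ler_pM; rewrite ?normr_ge0 ?fA ?gB ?gK ?fL.
Qed.

Lemma locally_lipschitzN f : locally_lipschitz f ->
  locally_lipschitz (fun x => - f x).
Proof.
move=> lf M; have [L [L0 fL]] := lf M; exists L; split=> // x y xM yM.
by rewrite -opprD normrN; exact: fL.
Qed.

Lemma locally_lipschitz_sum (K : Type) (s : seq K) (f : K -> (J -> R) -> R) :
  (forall k, locally_lipschitz (f k)) ->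
  locally_lipschitz (fun x => \sum_(k <- s) f k x).
Proof.
move=> lf; elim: s => [|k s IH].
  by move=> M; exists 0; split=> // x y _ _; rewrite !big_nil subrr normr0 mul0r.
move=> M; have [L [L0 fL]] := locally_lipschitzD (lf k) IH M.
by exists L; split=> // x y xM yM; rewrite !big_cons; exact: fL.
Qed.

End LocallyLipschitz.

Ltac lipschitz_pointwise :=
  repeat (first
    [ apply: locally_lipschitz_cst
    | apply: locally_lipschitz_coord
    | apply: locally_lipschitzN
    | apply: locally_lipschitz_sum => ?
    | apply: locally_lipschitzM
    | apply: locally_lipschitzD ]).

(** The squared distance [E] of two solutions satisfies [E' <= K * E] on a
    compact interval, where both solutions are bounded, so Gronwall's inequality
    keeps it equal to zero. *)
Lemma ode_uniqueness (R : realType) (J : finType) (F : J -> (J -> R) -> R)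
    (x y : R -> J -> R) (a b : R) :
  (forall j, locally_lipschitz (F j)) -> a <= b ->
  (forall t, a <= t <= b -> forall j,
     is_derive t 1 (x ^~ j) (F j (x t)) /\ is_derive t 1 (y ^~ j) (F j (y t))) ->
  (forall j, x a j = y a j) -> forall j, x b j = y b j.
Proof.
move=> lF ab ode xya.
have [M xyM] : exists M, forall j t, a <= t <= b -> `|x t j| <= M /\ `|y t j| <= M.
  have bnd j : {B : R | forall t, a <= t <= b -> `|x t j| <= B /\ `|y t j| <= B}.
    apply: cid.
    have [B [B0 xB]] := is_derive_bounded (fun t tab => (ode t tab j).1).
    have [C [C0 yC]] := is_derive_bounded (fun t tab => (ode t tab j).2).
    exists (B + C) => t tab; split.
      by apply: le_trans (xB t tab) _; rewrite lerDl.
    by apply: le_trans (yC t tab) _; rewrite lerDr.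
  exists (\sum_j `|sval (bnd j)|) => j t tab.
  have [xb yb] := svalP (bnd j) t tab.
  have le_ : sval (bnd j) <= \sum_j `|sval (bnd j)|.
    rewrite (bigD1 j)//=; apply: le_trans (ler_norm _) _.
    by rewrite lerDl sumr_ge0.
  by split; [exact: le_trans xb le_ | exact: le_trans yb le_].
have Lip j : {L : R | 0 <= L /\ forall u v, (forall i, `|u i| <= M) ->
    (forall i, `|v i| <= M) -> `|F j u - F j v| <= L * \sum_i `|u i - v i|}.
  by apply: cid; exact: lF.
pose L := \sum_j sval (Lip j).
have L0 : 0 <= L by apply: sumr_ge0 => j _; have [] := svalP (Lip j).
have FL j t : a <= t <= b -> `|F j (x t) - F j (y t)| <= L * \sum_i `|x t i - y t i|.
  move=> tab; have [Lj0 Lj] := svalP (Lip j).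
  apply: le_trans (Lj _ _ (fun i => (xyM i t tab).1) (fun i => (xyM i t tab).2)) _.
  rewrite ler_wpM2r ?sumr_ge0// /L (bigD1 j)//= lerDl.
  by apply: sumr_ge0 => i _; have [] := svalP (Lip i).
pose E t := \sum_j (x t j - y t j) ^+ 2.
pose dE t := \sum_j 2 * (x t j - y t j) * (F j (x t) - F j (y t)).
have EdE t : a <= t <= b -> is_derive t 1 E (dE t).
  move=> tab; apply: is_derive_sumf => j.
  by have [xd yd] := ode t tab j; derive_pointwise; ring.
(* Each product of two distances is at most half the sum of their squares. *)
have dEE t : a <= t <= b -> dE t <= 2 * L * #|J|%:R * E t.
  move=> tab.
  have -> : 2 * L * #|J|%:R * E t =
      \sum_j \sum_i L * ((x t j - y t j) ^+ 2 + (x t i - y t i) ^+ 2).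
    under eq_bigr do rewrite -mulr_sumr big_split /= sumr_const.
    rewrite -mulr_sumr big_split /= sumr_const -/(E t).
    by rewrite sumrMnl -/(E t) -(mulr_natr (E t)); ring.
  apply: ler_sum => j _; apply: le_trans (ler_norm _) _.
  rewrite normrM; apply: le_trans (ler_wpM2l _ (FL j t tab)) _; first exact: normr_ge0.
  rewrite mulrCA -mulr_sumr ler_wpM2l// mulr_sumr; apply: ler_sum => i _.
  rewrite normrM ger0_norm// -(real_normK (num_real (x t j - y t j))).
  rewrite -(real_normK (num_real (x t i - y t i))).
  have := sqr_ge0 (`|x t j - y t j| - `|x t i - y t i|).
  by rewrite sqrrB; lra.
have Eb : E b <= 0.
  apply: (gronwall_le0 ab EdE dEE); rewrite /E big1// => j _.
  by rewrite xya subrr expr0n.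
have E0 : E b = 0.
  by apply/eqP; rewrite eq_le Eb sumr_ge0// => i _; rewrite sqr_ge0.
move=> j; have /eqP := E0; rewrite psumr_eq0 => [/allP /(_ j)|i _]; last exact: sqr_ge0.
by rewrite mem_index_enum sqrf_eq0 subr_eq0 => /(_ isT) /eqP.
Qed.

(** * Local existence by power series *)

Lemma course_of_values (X : Type) (x0 : X) (step : nat -> (nat -> X) -> X) :
  (forall n u v, (forall i, (i <= n)%N -> u i = v i) -> step n u = step n v) ->
  exists a : nat -> X, a 0%N = x0 /\ forall n, a n.+1 = step n a.
Proof.
move=> ext.
(* [G n] agrees with the sequence to be constructed up to rank [n]. *)
pose fix G n : nat -> X := if n is m.+1
  then fun i => if (i <= m)%N then G m i else step m (G m) else fun=> x0.
have GE n i : (i <= n)%N -> G n i = G i i.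
  elim: n => [|n IH]; first by rewrite leqn0 => /eqP ->.
  rewrite leq_eqVlt => /orP[/eqP -> //|]; rewrite ltnS => lin.
  by rewrite [LHS]/= lin IH.
exists (fun n => G n n); split=> // n.
by rewrite [LHS]/= ltnn; apply: ext => i; exact: GE.
Qed.

Section CauchyProduct.
Variable R : realType.
Implicit Types (u v : R^nat) (B L t : R).

Definition cauchy_prod u v : R^nat := fun n => \sum_(i < n.+1) u i * v (n - i)%N.

Let series_recr u N : series u N.+1 = series u N + u N.
Proof. by rewrite /series /= big_nat_recr. Qed.

Lemma series_cauchy_prod u v N :
  series (cauchy_prod u v) N = \sum_(i < N) u i * series v (N - i)%N.
Proof.
elim: N => [|N IH]; first by rewrite /series /= big_geq// big_ord0.
rewrite series_recr IH /cauchy_prod.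
rewrite [in RHS]big_ord_recr /= [in LHS]big_ord_recr /= addrA -big_split /=.
congr (_ + _).
  by apply: eq_bigr => i _; rewrite -mulrDr subSn ?(ltnW (ltn_ord i))// series_recr.
by rewrite subnn subSn// subnn /series /= big_nat1.
Qed.

Lemma series_geometric_tail v B (N M : nat) :
  (forall n, `|v n| <= B * (4^-1) ^+ n) -> (N <= M)%N ->
  `|series v M - series v N| <= 4 / 3 * B * (4^-1 ^+ N - 4^-1 ^+ M).
Proof.
move=> vB; elim: M => [|M IH]; first by rewrite leqn0 => /eqP ->; rewrite !subrr normr0 mulr0.
rewrite leq_eqVlt => /orP[/eqP ->|]; first by rewrite !subrr normr0 mulr0.
rewrite ltnS => /IH {}IH.
rewrite series_recr.
rewrite (_ : _ - _ = (series v M - series v N) + v M); last by ring.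
apply: le_trans (ler_normD _ _) _; have := vB M; rewrite exprS; lra.
Qed.

Lemma series_geometric_cvg v B : (forall n, `|v n| <= B * (4^-1) ^+ n) ->
  cvgn (series v).
Proof.
move=> vB; apply: normed_cvg.
apply: (@series_le_cvg _ _ (geometric B 4^-1)) => //=.
- by move=> n; exact: le_trans (normr_ge0 _) (vB n).
- by apply: is_cvg_geometric_series; rewrite ger0_norm//; lra.
Qed.

(** The partial sums of the Cauchy product differ from the products of the
    partial sums of [u] with the full sum of [v] by [N] terms of size at most
    [4 ^- N], up to a constant. *)
Lemma cvg_cauchy_prod u v B :
  (forall n, `|u n| <= B * (4^-1) ^+ n) ->
  (forall n, `|v n| <= B * (4^-1) ^+ n) ->
  series (cauchy_prod u v) @ \oo --> limn (series u) * limn (series v).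
Proof.
move=> uB vB.
have B0 : 0 <= B by have := uB 0%N; rewrite mulr1; exact: le_trans.
have cu := series_geometric_cvg uB; have cv := series_geometric_cvg vB.
set U := limn _; set V := limn _.
have Vk k : `|V - series v k| <= 4 / 3 * B * 4^-1 ^+ k.
  have cVk : `|series v n - series v k| @[n --> \oo] --> `|V - series v k|.
    by apply: cvg_norm; apply: cvgB; [exact: cv | exact: cvg_cst].
  apply: (cvgr_to_le cVk); near=> n.
  have kn : (k <= n)%N by near: n; exact: nbhs_infty_ge.
  apply: le_trans (series_geometric_tail vB kn) _.
  rewrite ler_wpM2l//; first by rewrite mulr_ge0//; lra.
  by rewrite gerBl exprn_ge0//; lra.
have dist N : `|series u N * V - series (cauchy_prod u v) N| <=
    4 / 3 * B ^+ 2 * 2^-1 ^+ N.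
  rewrite series_cauchy_prod /series /= big_mkord mulr_suml -sumrB.
  apply: le_trans (ler_norm_sum _ _ _) _.
  have : \sum_(i < N) `|u i * V - u i * series v (N - i)%N| <=
      \sum_(i < N) 4 / 3 * B ^+ 2 * 4^-1 ^+ N.
    apply: ler_sum => i _; rewrite -mulrBr normrM.
    apply: le_trans (ler_pM _ _ (uB i) (Vk (N - i)%N)) _ => //.
    have -> : 4^-1 ^+ N = 4^-1 ^+ i * 4^-1 ^+ (N - i)%N :> R.
      by rewrite -exprD subnKC// ltnW.
    by move: (4^-1 ^+ i) (4^-1 ^+ (N - i)%N) => p q; lra.
  move=> /le_trans; apply; rewrite sumr_const card_ord -[leLHS]mulr_natr -[leLHS]mulrA.
  rewrite ler_wpM2l//; first by rewrite mulr_ge0 ?sqr_ge0//; lra.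
  have -> : (4^-1 : R) = 2^-1 * 2^-1 by lra.
  rewrite exprMn -mulrA ger_pMr; last by rewrite exprn_gt0//; lra.
  rewrite exprVn mulrC ler_pdivrMr ?exprn_gt0// mul1r -natrX ler_nat.
  exact: ltnW (ltn_expl N (ltnSn 1)).
have uV : series u n * V @[n --> \oo] --> U * V.
  by apply: cvgM; [exact: cu | exact: cvg_cst].
have d0 : series u n * V - series (cauchy_prod u v) n @[n --> \oo] --> (0 : R).
  apply/cvgr0Pnorm_lt => e e0.
  have h0 : `|2^-1 : R| < 1 by rewrite ger0_norm; lra.
  have /cvgr0Pnorm_lt /(_ e e0) := @cvg_geometric R (4 / 3 * B ^+ 2) _ h0.
  apply: filterS => n /= gn; apply: le_lt_trans gn.
  by apply: le_trans (dist n) _; exact: ler_norm.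
have -> : series (cauchy_prod u v) =
    (fun n => series u n * V - (series u n * V - series (cauchy_prod u v) n)).
  by apply/funext => n; rewrite subKr.
by rewrite -[U * V]subr0; exact: cvgB.
Unshelve. all: by end_near. Qed.

Lemma natS_le_exp2 n : n.+1%:R <= 2 ^+ n :> R.
Proof. by rewrite -natrX ler_nat ltn_expl. Qed.

Lemma pseries_diffs_bound u B L : 0 <= L -> (forall n, `|u n| <= B * L ^+ n) ->
  forall n, `|pseries_diffs u n| <= B * L * (2 * L) ^+ n.
Proof.
move=> L0 uB n; have B0 : 0 <= B by have := uB 0%N; rewrite mulr1; exact: le_trans.
rewrite /pseries_diffs normrM normr_nat.
apply: le_trans (ler_pM _ _ (natS_le_exp2 n) (uB n.+1)) _ => //.
by rewrite exprMn exprS le_eqVlt; apply/orP; left; apply/eqP; ring.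
Qed.

Lemma pseries_bound_cvg u B L t : (forall n, `|u n| <= B * L ^+ n) ->
  0 <= L -> L * `|t| <= 4^-1 -> cvgn (pseries u t).
Proof.
move=> uB L0 Lt; apply: (@series_geometric_cvg _ B) => n.
rewrite normrM normrX; have B0 : 0 <= B by have := uB 0%N; rewrite mulr1; exact: le_trans.
apply: le_trans (ler_wpM2r _ (uB n)) _; first by rewrite exprn_ge0.
by rewrite -mulrA -exprMn ler_wpM2l// lerXn2r// nnegrE ?mulr_ge0//; lra.
Qed.

(** Termwise differentiation needs the convergence of the series of second
    derivatives. Each derivation doubles the ratio [L] of the geometric bound,
    whence the radius [(16 * L)^-1], at which the bounds of the second
    derivatives still decay like [4 ^- n]. *)
Lemma is_derive_pseries u B L t : 0 < L -> (forall n, `|u n| <= B * L ^+ n) ->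
  `|t| < (16 * L)^-1 ->
  is_derive t 1 (fun s => limn (pseries u s)) (limn (pseries (pseries_diffs u) t)).
Proof.
move=> L0 uB tL.
have K0 : 0 < (16 * L)^-1 by rewrite invr_gt0; lra.
have LK : L * (16 * L)^-1 = 16^-1 by rewrite invfM mulrCA mulfV ?mulr1// gt_eqF.
have du := pseries_diffs_bound (ltW L0) uB.
have L20 : 0 <= 2 * L by lra.
have ddu := pseries_diffs_bound L20 du.
apply: (@pseries_snd_diffs _ u (16 * L)^-1); rewrite ?(gtr0_norm K0)//.
- by apply: (pseries_bound_cvg uB); rewrite ?(gtr0_norm K0); lra.
- by apply: (pseries_bound_cvg du); rewrite ?(gtr0_norm K0); lra.
- by apply: (pseries_bound_cvg ddu); rewrite ?(gtr0_norm K0); lra.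
Qed.

Lemma cauchy_prod_scale u v (t : R) n :
  cauchy_prod (fun i => u i * t ^+ i) (fun i => v i * t ^+ i) n =
  cauchy_prod u v n * t ^+ n.
Proof.
rewrite /cauchy_prod mulr_suml; apply: eq_bigr => i _.
have lin : (i <= n)%N by rewrite -ltnS.
have -> : t ^+ n = t ^+ i * t ^+ (n - i)%N by rewrite -exprD subnKC.
by ring.
Qed.

Lemma cvg_pseries_cauchy_prod u v B L t : 0 < L ->
  (forall n, `|u n| <= B * L ^+ n) -> (forall n, `|v n| <= B * L ^+ n) ->
  `|t| < (16 * L)^-1 ->
  pseries (cauchy_prod u v) t @ \oo --> limn (pseries u t) * limn (pseries v t).
Proof.
move=> L0 uB vB tL.
have Lt : L * `|t| <= 4^-1.
  have : `|t| * (16 * L) < 1 by rewrite -ltr_pdivlMr ?div1r//; lra.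
  by lra.
have bound (w : R^nat) : (forall n, `|w n| <= B * L ^+ n) ->
    forall n, `|w n * t ^+ n| <= B * 4^-1 ^+ n.
  move=> wB n; have B0 : 0 <= B by have := wB 0%N; rewrite mulr1; exact: le_trans.
  rewrite normrM normrX; apply: le_trans (ler_wpM2r _ (wB n)) _; first by rewrite exprn_ge0.
  by rewrite -mulrA -exprMn ler_wpM2l// lerXn2r// nnegrE ?mulr_ge0// ltW.
have := cvg_cauchy_prod (bound u uB) (bound v vB).
rewrite (_ : cauchy_prod _ _ = fun n => cauchy_prod u v n * t ^+ n)//.
by apply/funext => n; exact: cauchy_prod_scale.
Qed.

Lemma cauchy_prod_bound u v B L n :
  (forall i, (i <= n)%N -> `|u i| <= B * L ^+ i) ->
  (forall i, (i <= n)%N -> `|v i| <= B * L ^+ i) ->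
  `|cauchy_prod u v n| <= n.+1%:R * (B ^+ 2 * L ^+ n).
Proof.
move=> uB vB; apply: le_trans (ler_norm_sum _ _ _) _.
have -> : n.+1%:R * (B ^+ 2 * L ^+ n) = \sum_(i < n.+1) B ^+ 2 * L ^+ n.
  by rewrite sumr_const card_ord mulr_natl.
apply: ler_sum => i _; have lin : (i <= n)%N by rewrite -ltnS.
rewrite normrM; apply: le_trans (ler_pM _ _ (uB i lin) (vB (n - i)%N (leq_subr _ _))) _ => //.
have -> : L ^+ n = L ^+ i * L ^+ (n - i)%N by rewrite -exprD subnKC.
by rewrite le_eqVlt; apply/orP; left; apply/eqP; ring.
Qed.

End CauchyProduct.

(** The Taylor coefficients of the solution are determined recursively, and the
    recursion bounds them by a geometric sequence whose ratio depends only on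
    the bound [M] on the data. Hence the time of existence depends on [M]
    only. *)
Lemma local_existence (R : realType) (M : R) : 0 <= M ->
  exists2 h : R, 0 < h & forall D b1 : R, `|D| <= M -> `|b1| <= M ->
  exists b f : R -> R, [/\ b 0 = b1, f 0 = 1 & forall t : R, `|t| < h ->
    is_derive t 1 b (- 2^-1 * b t ^+ 2 + D * f t ^+ 2) /\
    is_derive t 1 f (b t * f t)].
Proof.
move=> M0; pose B := 1 + M; pose L := B ^+ 2.
have B1 : 1 <= B by rewrite lerDl.
have L0 : 0 < L by rewrite exprn_gt0//; lra.
exists (16 * L)^-1; first by rewrite invr_gt0; lra.
move=> D b1 DM bM.
pose step n (a : nat -> R * R) : R * R :=
  (n.+1%:R^-1 * (- 2^-1 * cauchy_prod (fst \o a) (fst \o a) n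
                 + D * cauchy_prod (snd \o a) (snd \o a) n),
   n.+1%:R^-1 * cauchy_prod (fst \o a) (snd \o a) n).
have [|a [a0 aS]] := @course_of_values _ (b1, 1) step.
  move=> n u v uv; rewrite /step.
  have prodE (p q : R * R -> R) :
      cauchy_prod (p \o u) (q \o u) n = cauchy_prod (p \o v) (q \o v) n.
    apply: eq_bigr => i _ /=; rewrite !uv ?leq_subr//.
    by rewrite -ltnS.
  by rewrite !prodE.
pose x n := (a n).1; pose y n := (a n).2.
have xS n : n.+1%:R * x n.+1 = - 2^-1 * cauchy_prod x x n + D * cauchy_prod y y n.
  by rewrite /x aS mulrA mulfV ?mul1r// pnatr_eq0.
have yS n : n.+1%:R * y n.+1 = cauchy_prod x y n.
  by rewrite /y aS mulrA mulfV ?mul1r// pnatr_eq0.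
have xyB n : forall i, (i <= n)%N -> `|x i| <= B * L ^+ i /\ `|y i| <= B * L ^+ i.
  elim: n => [|n IH] i.
    rewrite leqn0 => /eqP ->; rewrite /x /y a0 /= mulr1 normr1 B1; split=> //.
    by rewrite /B; lra.
  rewrite leq_eqVlt => /orP[/eqP -> {i}|]; last by rewrite ltnS; exact: IH.
  have xB i : (i <= n)%N -> `|x i| <= B * L ^+ i by move=> /IH[].
  have yB i : (i <= n)%N -> `|y i| <= B * L ^+ i by move=> /IH[].
  have n0 : 0 < n.+1%:R :> R by rewrite ltr0n.
  have Ln : 0 <= n.+1%:R * (B ^+ 2 * L ^+ n).
    by rewrite mulr_ge0// mulr_ge0// ?sqr_ge0// exprn_ge0// ltW.
  have LS : n.+1%:R * (B * L ^+ n.+1) = B * (n.+1%:R * (B ^+ 2 * L ^+ n)).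
    by rewrite exprS /L; ring.
  split; rewrite -(ler_pM2l n0) -[X in X * `|_|](ger0_norm (ltW n0)) -normrM.
    rewrite xS LS; apply: le_trans (ler_normD _ _) _; rewrite !normrM.
    have cx := cauchy_prod_bound xB xB; have cy := cauchy_prod_bound yB yB.
    have : `|D| * `|cauchy_prod y y n| <= M * (n.+1%:R * (B ^+ 2 * L ^+ n)).
      exact: ler_pM.
    rewrite normrN (ger0_norm (_ : 0 <= 2^-1)); last by lra.
    by rewrite /B in cx cy Ln *; lra.
  rewrite yS LS; apply: le_trans (cauchy_prod_bound xB yB) _.
  by rewrite ler_peMl.
have xB i : `|x i| <= B * L ^+ i by have [] := xyB i i (leqnn i).
have yB i : `|y i| <= B * L ^+ i by have [] := xyB i i (leqnn i).
have at0 (u : R^nat) : limn (pseries u 0) = u 0%N.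
  apply/cvg_lim => //; apply: cvg_near_cst; near=> n.
  have n0 : (0 < n)%N by near: n; exact: nbhs_infty_gt.
  rewrite /pseries /series /= big_ltn// expr0 mulr1 big_nat_cond big1 ?addr0//.
  by move=> i /andP[/andP[i0 _] _]; rewrite expr0n gtn_eqF// mulr0.
exists (fun t => limn (pseries x t)), (fun t => limn (pseries y t)); split.
- by rewrite at0 /x a0.
- by rewrite at0 /y a0.
move=> t tL; split; apply: is_derive_eq.
- exact: (is_derive_pseries L0 xB tL).
- apply/cvg_lim => //.
  have cx := cvg_pseries_cauchy_prod L0 xB xB tL.
  have cy := cvg_pseries_cauchy_prod L0 yB yB tL.
  have -> : pseries (pseries_diffs x) t = (fun n =>
      - 2^-1 * pseries (cauchy_prod x x) t n + D * pseries (cauchy_prod y y) t n).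
    apply/funext => n; rewrite /pseries /series /= !mulr_sumr -big_split /=.
    by apply: eq_bigr => i _; rewrite /pseries_diffs xS mulrDl !mulrA.
  rewrite !expr2.
  by apply: cvgD; (apply: cvgM; first exact: cvg_cst); [exact: cx | exact: cy].
- exact: (is_derive_pseries L0 yB tL).
- apply/cvg_lim => //.
  have := cvg_pseries_cauchy_prod L0 xB yB tL.
  rewrite (_ : cauchy_prod x y = pseries_diffs y)//.
  by apply/funext => n; rewrite -yS.
Unshelve. all: by end_near. Qed.

(** * The strain-vorticity system: uniqueness and symmetry *)

Section StrainVorticitySystem.
Variable R : realType.

Local Notation J := ('I_3 * 'I_3 + 'I_3)%type.
Implicit Types (x : J -> R) (S : 'M[R]_3) (w : 'cV[R]_3).

Definition sv_state S w : J -> R :=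
  fun j => match j with inl p => S p.1 p.2 | inr i => w i 0 end.

Definition sv_field (j : J) x : R :=
  match j with
  | inl p =>
      - (\sum_l x (inl (p.1, l)) * x (inl (l, p.2)))
      + (3^-1 * \sum_a \sum_b x (inl (a, b)) * x (inl (a, b))) * (p.1 == p.2)%:R
      + - (4^-1 * (x (inr p.1) * x (inr p.2)))
      + (12^-1 * \sum_a x (inr a) * x (inr a)) * (p.1 == p.2)%:R
  | inr i => \sum_l x (inl (i, l)) * x (inr l)
  end.

Lemma sv_field_lipschitz j : locally_lipschitz (sv_field j).
Proof. by case: j => [[i k]|i] /=; lipschitz_pointwise. Qed.

Definition sv_flow (a b : R) (x : R -> J -> R) := forall t, a <= t <= b ->
  forall j, is_derive t 1 (x ^~ j) (sv_field j (x t)).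

Lemma sv_flow_uniqueness a b (x y : R -> J -> R) : a <= b ->
  sv_flow a b x -> sv_flow a b y -> x a =1 y a -> x b =1 y b.
Proof.
move=> ab xf yf; apply: (ode_uniqueness (F := sv_field)) => //.
  exact: sv_field_lipschitz.
by move=> t tab j; split; [exact: xf | exact: yf].
Qed.

Let sqnorm_mx S : sqnorm S = \sum_a \sum_b S a b * S a b.
Proof. by apply: eq_bigr => a _; apply: eq_bigr => b _; rewrite expr2. Qed.

Let sqnorm_col w : sqnorm w = \sum_a w a 0 * w a 0.
Proof. by apply: eq_bigr => a _; rewrite big_ord1 expr2. Qed.

Lemma sv_solution_flow (T : \bar R) (S : R -> 'M[R]_3) (w : R -> 'cV[R]_3) :
  sv_solution T S w -> exists x : R -> J -> R,
  (forall t, time_interval T t -> x t = sv_state (S t) (w t)) /\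
  forall t, time_interval T t -> sv_flow 0 t x.
Proof.
case=> T0 SC1 wC1 _ _ strain vorticity.
have [F FS] := C1_in_extension SC1; have [G Gw] := C1_in_extension wC1.
have FGE t : time_interval T t -> sv_state (F t) (G t) = sv_state (S t) (w t).
  by move=> It; rewrite (FS t It).1 (Gw t It).1.
exists (fun t => sv_state (F t) (G t)); split=> [//|t It s /andP[s0 st] j].
have Is : time_interval T s := time_interval_le It s0 st.
rewrite FGE//; have [_ dF] := FS s Is; have [_ dG] := Gw s Is.
case: j => [[i k]|i] /=.
  apply: is_derive_eq; first exact: (is_derive_coord i k dF).
  have := strain s Is; move=> /(congr1 (fun M : 'M[R]_3 => M i k)).
  rewrite sqnorm_mx sqnorm_col !mxE big_ord1 !mxE => E.
  by apply: subr0_eq; rewrite -[RHS]E; ring.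
apply: is_derive_eq; first exact: (is_derive_coord i 0 dG).
by have /eqP := vorticity s Is; rewrite subr_eq0 => /eqP ->; rewrite mxE.
Qed.

Lemma sv_solution_uniqueness (T T' : \bar R) (S S' : R -> 'M[R]_3)
    (w w' : R -> 'cV[R]_3) :
  sv_solution T S w -> sv_solution T' S' w' -> S 0 = S' 0 -> w 0 = w' 0 ->
  forall t, time_interval T t -> time_interval T' t -> S t = S' t /\ w t = w' t.
Proof.
move=> sol sol' S0 w0 t It It'.
have [x [xE xf]] := sv_solution_flow sol.
have [y [yE yf]] := sv_solution_flow sol'.
have t0 : 0 <= t by case: It.
have xy : x t =1 y t.
  apply: (sv_flow_uniqueness t0 (xf t It) (yf t It')).
  rewrite (xE 0 (time_interval_le It (lexx 0) t0)).
  by rewrite (yE 0 (time_interval_le It' (lexx 0) t0)) S0 w0.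
rewrite (xE t It) (yE t It') in xy.
split; first by apply/matrixP => i k; exact: (xy (inl (i, k))).
by apply/colP => i; exact: (xy (inr i)).
Qed.

(** If the other solution lived longer, it would extend the maximal one. *)
Lemma sv_maximal_unique (T T' : \bar R) (S S' : R -> 'M[R]_3)
    (w w' : R -> 'cV[R]_3) :
  sv_maximal_solution T S w -> sv_solution T' S' w' -> S' 0 = S 0 -> w' 0 = w 0 ->
  (T' <= T)%E /\ forall t, time_interval T' t -> S' t = S t /\ w' t = w t.
Proof.
move=> [sol max] sol' S0 w0.
have agree := sv_solution_uniqueness sol' sol S0 w0.
have T'T : (T' <= T)%E.
  rewrite leNgt; apply/negP => TT'.
  suff : (T' <= T)%E by rewrite leNgt TT'.
  apply: (max _ _ _ sol') => t It; apply: agree => //.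
  by case: It => t0 tT; split=> //; exact: lt_trans tT TT'.
split=> // t It; apply: agree => //.
by case: It => t0 tT; split=> //; exact: lt_le_trans tT T'T.
Qed.

(** * Reflection symmetry *)

Definition reflect_state (i0 : 'I_3) x : J -> R :=
  let sg i : R := if i == i0 then - 1 else 1 in
  fun j => match j with
  | inl p => sg p.1 * sg p.2 * x (inl p)
  | inr i => sg i * x (inr i)
  end.

Lemma sv_field_reflect i0 x j :
  sv_field j (reflect_state i0 x) = reflect_state i0 (sv_field ^~ x) j.
Proof.
pose sg i : R := if i == i0 then - 1 else 1.
have sg2 i : sg i * sg i = 1 by rewrite /sg; case: ifP => _; rewrite ?mulrNN mulr1.
case: j => [[i k]|i] /=; rewrite -/(sg i) -?/(sg k).
  have -> : \sum_l sg i * sg l * x (inl (i, l)) * (sg l * sg k * x (inl (l, k))) =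
      sg i * sg k * \sum_l x (inl (i, l)) * x (inl (l, k)).
    rewrite mulr_sumr; apply: eq_bigr => l _; rewrite -[RHS]mul1r -(sg2 l); ring.
  have -> : \sum_a \sum_b sg a * sg b * x (inl (a, b)) * (sg a * sg b * x (inl (a, b))) =
      \sum_a \sum_b x (inl (a, b)) * x (inl (a, b)).
    apply: eq_bigr => a _; apply: eq_bigr => b _.
    transitivity (sg a * sg a * (sg b * sg b) * (x (inl (a, b)) * x (inl (a, b)))).
      by ring.
    by rewrite !sg2 !mul1r.
  have -> : \sum_a sg a * x (inr a) * (sg a * x (inr a)) =
      \sum_a x (inr a) * x (inr a).
    by apply: eq_bigr => a _; rewrite -[RHS]mul1r -(sg2 a); ring.
  have ik : sg i * sg k * (i == k)%:R = (i == k)%:R.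
    by have [<-|_] := eqVneq i k; rewrite ?mulr0// sg2 mulr1.
  move: ik; move: ((i == k)%:R) => d ik.
  by rewrite -[in LHS]ik; ring.
rewrite mulr_sumr; apply: eq_bigr => l _; rewrite -/(sg l).
by rewrite -[RHS]mul1r -(sg2 l); ring.
Qed.

Lemma sv_flow_reflect i0 a b (x : R -> J -> R) : sv_flow a b x ->
  sv_flow a b (fun t => reflect_state i0 (x t)).
Proof.
move=> xf t tab j; rewrite sv_field_reflect.
have xd := xf t tab.
case: j => [[i k]|i] /=.
  have xdik := xd (inl (i, k)).
  by derive_pointwise; rewrite mul0r add0r.
have xdi := xd (inr i).
by derive_pointwise; rewrite mul0r add0r.
Qed.

(** For [i0 != 1] the reflection in the coordinate plane orthogonal to the axis
    [i0] fixes the initial state, hence by uniqueness the whole solution; it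
    changes the sign of the entries that are claimed to vanish. *)
Lemma sv_flow_diagonal a b (x : R -> J -> R) : a <= b -> sv_flow a b x ->
  (forall i k, i != k -> x a (inl (i, k)) = 0) ->
  (forall i, i != 1 -> x a (inr i) = 0) ->
  (forall i k, i != k -> x b (inl (i, k)) = 0) /\
  (forall i, i != 1 -> x b (inr i) = 0).
Proof.
move=> ab xf offdiag transverse.
have fixed i0 : i0 != 1 -> reflect_state i0 (x b) =1 x b.
  move=> i01; apply: (sv_flow_uniqueness ab (sv_flow_reflect i0 xf) xf).
  case=> [[i k]|i] /=.
    have [<-|ik] := eqVneq i k; last by rewrite offdiag// mulr0.
    by case: ifP => _; rewrite ?mulrNN mulr1 mul1r.
  case: ifP => [/eqP ->|_]; last by rewrite mul1r.
  by rewrite transverse// mulr0.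
have opp_eq0 (c : R) : - c = c -> c = 0 by move=> h; lra.
have off i k : i != k -> i != 1 -> x b (inl (i, k)) = 0 /\ x b (inl (k, i)) = 0.
  move=> ik i1; split; apply: opp_eq0.
    have /= := fixed i i1 (inl (i, k)).
    by rewrite eqxx (eq_sym k) (negbTE ik) mulr1 mulN1r.
  have /= := fixed i i1 (inl (k, i)).
  by rewrite eqxx (eq_sym k) (negbTE ik) mul1r mulN1r.
split=> [i k ik|i i1].
  have [i1|i1] := eqVneq i 1; last by have [] := off i k ik i1.
  have k1 : k != 1 by rewrite -i1 eq_sym.
  by rewrite eq_sym in ik; have [] := off k i ik k1.
by apply: opp_eq0; have /= := fixed i i1 (inr i); rewrite eqxx mulN1r.
Qed.

(** * Reduction to the stretching rate along the vorticity *)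

(** In the diagonal case the vorticity, of component [u], and the difference [p]
    of the two other strain eigenvalues are both stretched at the rate [b], the
    eigenvalue along the vorticity. *)
Definition reduced_flow (T : \bar R) (b p u : R -> R) := forall t, time_interval T t ->
  [/\ is_derive t 1 b (- 2^-1 * b t ^+ 2 + 6^-1 * (p t ^+ 2 - u t ^+ 2)),
      is_derive t 1 p (b t * p t) & is_derive t 1 u (b t * u t)].

Definition reduced_strain (b p : R) : 'M[R]_3 :=
  diag_mx (\row_(j < 3) [:: - 2^-1 * (b + p); b; 2^-1 * (p - b)]`_j).

Definition reduced_vorticity (u : R) : 'cV[R]_3 := \col_(i < 3) [:: 0; u; 0]`_i.

Lemma reduced_flow_sv_solution (T : \bar R) (b p u : R -> R) : (0 < T)%E ->
  reduced_flow T b p u ->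
  sv_solution T (fun t => reduced_strain (b t) (p t)) (fun t => reduced_vorticity (u t)).
Proof.
move=> T0 red.
have dS (c q : R -> R) (t dc dq : R) : is_derive t 1 c dc -> is_derive t 1 q dq ->
    is_derive t 1 (fun s => reduced_strain (c s) (q s)) (reduced_strain dc dq).
  move=> cd qd; apply: is_derive_matrix => i k; rewrite !mxE.
  under [X in is_derive _ _ X]eq_fun do rewrite !mxE.
  have [_|_] := eqVneq i k; last by rewrite !mulr0n; exact: is_derive_cst.
  rewrite !mulr1n; case: i => [[|[|[|//]]] hi] /=.
  - by derive_pointwise; ring.
  - by [].
  - by derive_pointwise; ring.
have dw (c : R -> R) (t dc : R) : is_derive t 1 c dc ->
    is_derive t 1 (fun s => reduced_vorticity (c s)) (reduced_vorticity dc).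
  move=> cd; apply: is_derive_matrix => i k; rewrite !mxE.
  under [X in is_derive _ _ X]eq_fun do rewrite !mxE.
  by case: i => [[|[|[|//]]] hi] //=; exact: is_derive_cst.
pose db t := - 2^-1 * b t ^+ 2 + 6^-1 * (p t ^+ 2 - u t ^+ 2).
pose dp t := b t * p t; pose du t := b t * u t.
have cts (n : nat) (F : R -> 'M[R]_(3, n)) (t : R) D : is_derive t 1 F D -> {for t, continuous F}.
  by move=> [/derivable1_diffP /differentiable_continuous].
have [SC1 SE] : C1_in (time_interval T) (fun t => reduced_strain (b t) (p t)) /\
    forall t, time_interval T t ->
      deriv_in (time_interval T) (fun t => reduced_strain (b t) (p t)) t =
      reduced_strain (db t) (dp t).
  apply: (C1_in_of_is_derive (F := fun t => reduced_strain (b t) (p t))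
    (D := fun t => reduced_strain (db t) (dp t))).
  - by [].
  - by move=> t /red[bd pd ud]; exact: dS.
  - move=> t /red[bd pd ud].
    have [ddb dbd] : exists d, is_derive t 1 db d.
      by eexists; rewrite /db; derive_pointwise; reflexivity.
    have dpd := is_derive_mulf bd pd.
    exact: cts (dS _ _ _ _ _ dbd dpd).
have [wC1 wE] : C1_in (time_interval T) (fun t => reduced_vorticity (u t)) /\
    forall t, time_interval T t ->
      deriv_in (time_interval T) (fun t => reduced_vorticity (u t)) t =
      reduced_vorticity (du t).
  apply: (C1_in_of_is_derive (F := fun t => reduced_vorticity (u t))
    (D := fun t => reduced_vorticity (du t))).
  - by [].
  - by move=> t /red[bd pd ud]; exact: dw.
  - move=> t /red[bd pd ud].
    exact: cts (dw _ _ _ (is_derive_mulf bd ud)).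
split=> // t It.
- exact: tr_diag_mx.
- by rewrite mxtrace_diag !big_ord_recl big_ord0 !mxE /=; lra.
- rewrite SE//; apply/matrixP => i k.
  rewrite /sqnorm !(mxE, big_ord_recl, big_ord0) /= /db /dp.
  case: i => [[|[|[|//]]] hi]; case: k => [[|[|[|//]]] hk] /=;
    by rewrite ?mulr1n ?mulr0n; field.
- rewrite wE//; apply/colP => i.
  rewrite !(mxE, big_ord_recl, big_ord0) /= /du.
  by case: i => [[|[|[|//]]] hi] /=; rewrite ?mulr1n ?mulr0n; field.
Qed.

Let big_ord3 (f : 'I_3 -> R) : \sum_l f l = f 0 + f 1 + f 2%:R.
Proof.
rewrite !big_ord_recl big_ord0 addr0 addrA.
by congr (_ + f _ + f _); exact: val_inj.
Qed.

Lemma sv_solution_reduced (T : \bar R) (S : R -> 'M[R]_3) (w : R -> 'cV[R]_3)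
    (b0 p0 u0 : R) :
  sv_solution T S w -> S 0 = reduced_strain b0 p0 -> w 0 = reduced_vorticity u0 ->
  exists b p u : R -> R, reduced_flow T b p u /\
    [/\ b 0 = b0, p 0 = p0 & u 0 = u0] /\
    forall t, time_interval T t ->
      S t = reduced_strain (b t) (p t) /\ w t = reduced_vorticity (u t).
Proof.
move=> sol S0 w0; have [x [xE xf]] := sv_solution_flow sol.
have I0 : time_interval T 0 by apply: time_interval0; exact: sv_T_gt0 sol.
pose i0 : 'I_3 := 0; pose i1 : 'I_3 := 1; pose i2 : 'I_3 := 2%:R.
have diag t : time_interval T t ->
    (forall i k, i != k -> x t (inl (i, k)) = 0) /\ (forall i, i != 1 -> x t (inr i) = 0).
  move=> It; apply: sv_flow_diagonal (xf t It) _ _; first by case: It.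
    by move=> i k ik; rewrite xE//= S0 mxE (negbTE ik).
  by move=> i i1'; rewrite xE//= w0 mxE; case: i i1' => [[|[|[|//]]] hi].
have tr t : time_interval T t -> x t (inl (i0, i0)) + x t (inl (i1, i1)) + x t (inl (i2, i2)) = 0.
  by move=> It; have := sv_S_tr sol It; rewrite xE//= /mxtrace big_ord3.
exists (fun t => x t (inl (i1, i1))), (fun t => x t (inl (i2, i2)) - x t (inl (i0, i0))),
  (fun t => x t (inr i1)).
split; [|split].
- move=> t It; have [off trans] := diag t It; have trt := tr t It.
  have tt : 0 <= t <= t by case: It => t0 _; rewrite t0 lexx.
  have d0 := xf t It t tt (inl (i0, i0)); have d1 := xf t It t tt (inl (i1, i1)).
  have d2 := xf t It t tt (inl (i2, i2)); have dw := xf t It t tt (inr i1).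
  have z01 : x t (inl (i0, i1)) = 0 by exact: off.
  have z02 : x t (inl (i0, i2)) = 0 by exact: off.
  have z10 : x t (inl (i1, i0)) = 0 by exact: off.
  have z12 : x t (inl (i1, i2)) = 0 by exact: off.
  have z20 : x t (inl (i2, i0)) = 0 by exact: off.
  have z21 : x t (inl (i2, i1)) = 0 by exact: off.
  have w00 : x t (inr i0) = 0 by exact: trans.
  have w20 : x t (inr i2) = 0 by exact: trans.
  have x00 : x t (inl (i0, i0)) = - x t (inl (i1, i1)) - x t (inl (i2, i2)) by lra.
  rewrite /= !big_ord3 ?eqxx z01 z02 z10 z12 z20 z21 w00 w20 x00 in d0 d1 d2 dw.
  split.
  - by apply: (is_derive_eq d1); rewrite ?x00 ?mulr1n; field.
  - by apply: (is_derive_eq (is_derive_addf d2 (is_derive_oppf d0))); rewrite ?x00; field.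
  - by apply: (is_derive_eq dw); field.
- rewrite xE//= S0 w0 !mxE /=; split=> //; lra.
- move=> t It; have [off trans] := diag t It; have trt := tr t It.
  rewrite xE// in off trans trt *; split.
    apply/matrixP => i k; rewrite mxE; have [<-|ik] := eqVneq i k; last first.
      by rewrite mulr0n; exact: off.
    rewrite mulr1n mxE; move: trt => /= trt.
    case: i => [[|[|[|//]]] hi] /=.
    - by rewrite (_ : Ordinal hi = i0); [lra | exact: val_inj].
    - by congr (S t _ _); exact: val_inj.
    - by rewrite (_ : Ordinal hi = i2); [lra | exact: val_inj].
  apply/colP => i; rewrite mxE.
  case: i => [[|[|[|//]]] hi] /=; [exact: trans | | exact: trans].
  by congr (w t _ _); exact: val_inj.
Qed.

End StrainVorticitySystem.

(** * Continuation of bounded solutions *)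

Section Continuation.
Variable R : realType.
Implicit Types (b p u : R -> R).

Lemma is_derive_glue (f g : R -> R) (t0 t1 T : R) : t0 < t1 -> t1 < T ->
  (forall s, t0 <= s -> s < T -> f s = g s) ->
  let k s := if s < t1 then f s else g s in
  (forall t d : R, t < t1 -> is_derive t 1 f d -> is_derive t 1 k d) /\
  (forall t d : R, t1 <= t -> is_derive t 1 g d -> is_derive t 1 k d).
Proof.
move=> t01 t1T fg k; split=> t d tt1; apply: near_eq_is_derive.
  by near=> s; rewrite /k ifT//; near: s; exact: lt_nbhsl.
near=> s; rewrite /k; case: ifPn => // st1; rewrite fg//.
  by apply: ltW; near: s; apply: lt_nbhsr; exact: lt_le_trans tt1.
exact: lt_trans t1T.
Unshelve. all: by end_near. Qed.

Let reduced_state (b p u : R) (j : option bool) : R :=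
  match j with None => b | Some true => p | Some false => u end.

Let reduced_field (j : option bool) (x : option bool -> R) : R :=
  match j with
  | None => - 2^-1 * (x None * x None) +
      6^-1 * (x (Some true) * x (Some true) + - (x (Some false) * x (Some false)))
  | Some k => x None * x (Some k)
  end.

Lemma reduced_flow_uniqueness (a c : R) b p u b' p' u' : a <= c ->
  (forall t, a <= t <= c ->
     [/\ is_derive t 1 b (- 2^-1 * b t ^+ 2 + 6^-1 * (p t ^+ 2 - u t ^+ 2)),
         is_derive t 1 p (b t * p t) & is_derive t 1 u (b t * u t)] /\
     [/\ is_derive t 1 b' (- 2^-1 * b' t ^+ 2 + 6^-1 * (p' t ^+ 2 - u' t ^+ 2)),
         is_derive t 1 p' (b' t * p' t) & is_derive t 1 u' (b' t * u' t)]) ->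
  b a = b' a -> p a = p' a -> u a = u' a ->
  [/\ b c = b' c, p c = p' c & u c = u' c].
Proof.
move=> ac flow ba pa ua.
have E := @ode_uniqueness R (option bool) reduced_field
  (fun t => reduced_state (b t) (p t) (u t))
  (fun t => reduced_state (b' t) (p' t) (u' t)) a c.
have {}E : forall j, reduced_state (b c) (p c) (u c) j =
    reduced_state (b' c) (p' c) (u' c) j.
  apply: E => //.
  - by case=> [k|] /=; lipschitz_pointwise.
  - move=> t /flow[[bd pd ud] [bd' pd' ud']].
    by case=> [[|]|] /=; rewrite -?expr2.
  - by case=> [[|]|] /=.
by split; [exact: (E None) | exact: (E (Some true)) | exact: (E (Some false))].
Qed.

(** The time of existence given by [local_existence] is the same for all states
    in a bounded set, so a solution started close enough to the end time goes
    past it. *)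
Lemma reduced_flow_extension (T M : R) b p u : 0 < T ->
  reduced_flow T%:E b p u ->
  (forall t, time_interval T%:E t -> [/\ `|b t| <= M, `|p t| <= M & `|u t| <= M]) ->
  exists (T' : R) b' p' u', [/\ T < T', reduced_flow T'%:E b' p' u' &
    [/\ b' 0 = b 0, p' 0 = p 0 & u' 0 = u 0]].
Proof.
move=> T0 red bnd.
have M0 : 0 <= M.
  have [|+ _ _] := bnd 0; first by split=> //=; rewrite lte_fin.
  exact: le_trans.
have M'0 : 0 <= M + M ^+ 2 by rewrite addr_ge0// sqr_ge0.
have [h h0 loc] := local_existence M'0.
(* The solution is restarted at time [t0], at most [h / 2] before [T], and the
   two solutions are joined at the time [t1] inside their common domain, so that
   differentiability needs no matching at the junction. *)
pose t0 := Num.max 0 (T - h / 2).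
have t00 : 0 <= t0 by rewrite le_max lexx.
have t0T : t0 < T by rewrite gt_max T0 gtrBl divr_gt0.
have t0h : T < t0 + h.
  have : T - h / 2 <= t0 by rewrite le_max lexx orbT.
  by lra.
pose t1 := (t0 + T) / 2.
have t01 : t0 < t1 by rewrite /t1; lra.
have t1T : t1 < T by rewrite /t1; lra.
have It t : 0 <= t -> t < T -> time_interval T%:E t by split=> //; rewrite lte_fin.
have [bM pM uM] := bnd t0 (It t0 t00 t0T).
have [||beta [f [beta0 f0 ode]]] := loc (6^-1 * (p t0 ^+ 2 - u t0 ^+ 2)) (b t0).
- have := real_normK (num_real (p t0)); have := real_normK (num_real (u t0)).
  have := lerXn2r 2 (normr_ge0 _ : `|p t0| \in Num.nneg) (M0 : M \in Num.nneg) pM.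
  have := lerXn2r 2 (normr_ge0 _ : `|u t0| \in Num.nneg) (M0 : M \in Num.nneg) uM.
  have := sqr_ge0 (p t0); have := sqr_ge0 (u t0) => u2 p2 uM2 pM2 uE pE.
  by rewrite uE pE in uM2 pM2 *; rewrite ler_norml; apply/andP; split; lra.
- by apply: le_trans bM _; rewrite lerDl sqr_ge0.
pose gb s := beta (s - t0); pose gp s := p t0 * f (s - t0); pose gu s := u t0 * f (s - t0).
have gflow t : t0 <= t -> t < t0 + h ->
    [/\ is_derive t 1 gb (- 2^-1 * gb t ^+ 2 + 6^-1 * (gp t ^+ 2 - gu t ^+ 2)),
        is_derive t 1 gp (gb t * gp t) & is_derive t 1 gu (gb t * gu t)].
  move=> t0t tt0h; have [|db df] := ode (t - t0).
    by rewrite ger0_norm ?subr_ge0// ltrBlDl.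
  have {}db := is_derive_shiftf db; have {}df := is_derive_shiftf df.
  split.
  - by apply: (is_derive_eq db); rewrite /gp /gu /gb; ring.
  - by rewrite /gp; derive_pointwise; rewrite /gb; ring.
  - by rewrite /gu; derive_pointwise; rewrite /gb; ring.
have agree s : t0 <= s -> s < T -> [/\ b s = gb s, p s = gp s & u s = gu s].
  move=> t0s sT; apply: (reduced_flow_uniqueness t0s).
  - move=> t /andP[t0t ts]; split.
      by apply: red; apply: It; [exact: le_trans t0t | exact: le_lt_trans sT].
    by apply: gflow => //; apply: lt_trans t0h; exact: le_lt_trans sT.
  - by rewrite /gb subrr beta0.
  - by rewrite /gp subrr f0 mulr1.
  - by rewrite /gu subrr f0 mulr1.
have [bl br] := is_derive_glue t01 t1T (fun s h1 h2 => let: And3 e _ _ := agree s h1 h2 in e).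
have [pl pr] := is_derive_glue t01 t1T (fun s h1 h2 => let: And3 _ e _ := agree s h1 h2 in e).
have [ul ur] := is_derive_glue t01 t1T (fun s h1 h2 => let: And3 _ _ e := agree s h1 h2 in e).
exists (t0 + h), (fun s => if s < t1 then b s else gb s),
  (fun s => if s < t1 then p s else gp s), (fun s => if s < t1 then u s else gu s).
split=> //; last by rewrite (le_lt_trans t00 t01).
move=> t [tge0]; rewrite lte_fin => tT'.
have [tt1|t1t] := ltP t t1.
  have [|bd pd ud] := red t; first by apply: It => //; exact: lt_trans t1T.
  by split; [exact: bl | exact: pl | exact: ul].
have [||bd pd ud] := gflow t => //; first by apply: le_trans t1t; exact: ltW.
by split; [exact: br | exact: pr | exact: ur].
Qed.

Definition reduced_maximal (T : \bar R) b p u :=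
  forall (T' : \bar R) b' p' u', (0 < T')%E -> reduced_flow T' b' p' u' ->
    b' 0 = b 0 -> p' 0 = p 0 -> u' 0 = u 0 -> (T' <= T)%E.

Lemma reduced_maximal_unbounded (T M : R) b p u : 0 < T ->
  reduced_flow T%:E b p u -> reduced_maximal T%:E b p u ->
  ~ (forall t, time_interval T%:E t -> [/\ `|b t| <= M, `|p t| <= M & `|u t| <= M]).
Proof.
move=> T0 red max bnd.
have [T' [b' [p' [u' [TT' red' [b0 p0 u0]]]]]] := reduced_flow_extension T0 red bnd.
have : (T'%:E <= T%:E)%E.
  by apply: (max _ _ _ _ _ red') => //; rewrite lte_fin (lt_trans T0).
by rewrite lee_fin leNgt TT'.
Qed.

End Continuation.

(** * The amplitude of the stretching *)

Section Amplitude.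
Variable R : realType.
Implicit Types (b p u y v : R -> R).

(** The square of the amplitude [y] is the factor by which [p] and [u] have been
    stretched. The last field is the energy integral of the oscillator
    [y'' = E / 12 * y ^+ 5]. *)
Record amplitude_flow (T : \bar R) (E q : R) y v : Prop := AmplitudeFlow {
  amplitude_T_gt0 : (0 < T)%E ;
  amplitude_init : y 0 = 1 ;
  amplitude_gt0 : forall t, time_interval T t -> 0 < y t ;
  amplitude_y : forall t, time_interval T t -> is_derive t 1 y (2^-1 * v t) ;
  amplitude_v : forall t, time_interval T t -> is_derive t 1 v (6^-1 * E * y t ^+ 5) ;
  amplitude_energy : forall t, time_interval T t -> 9 * v t ^+ 2 = E * y t ^+ 6 - q
}.

(** The quantity [p ^+ 2 - u ^+ 2 - 9 * b ^+ 2] is damped exactly at the rate at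
    which [p] and [u] are stretched. Hence it keeps its sign and its quotient
    with its initial value is the inverse of the stretching factor. *)
Lemma reduced_flow_amplitude (T : \bar R) b p u : (0 < T)%E ->
  reduced_flow T b p u ->
  let E := p 0 ^+ 2 - u 0 ^+ 2 in
  let q := E - 9 * b 0 ^+ 2 in
  q != 0 ->
  exists y v, amplitude_flow T E q y v /\ forall t, time_interval T t ->
    [/\ p t = p 0 * y t ^+ 2, u t = u 0 * y t ^+ 2 & b t = v t / y t].
Proof.
move=> T0 red E q q0.
have I0 : time_interval T 0 by exact: time_interval0.
pose f t := q^-1 * (p t ^+ 2 - u t ^+ 2 - 9 * b t ^+ 2).
have f0 : f 0 = 1 by rewrite /f -/E -/q mulVf.
have fd t : time_interval T t -> is_derive t 1 f (- b t * f t).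
  by move=> /red[bd pd ud]; rewrite /f; derive_pointwise; field.
have fgt0 t : time_interval T t -> 0 < f t.
  move=> It; have t0 : 0 <= t by case: It.
  have bdd s : 0 <= s <= t -> time_interval T s.
    by move=> /andP[s0 st]; exact: time_interval_le It s0 st.
  have [M [M0 bM]] := is_derive_bounded (f := b) (df := fun s =>
    - 2^-1 * b s ^+ 2 + 6^-1 * (p s ^+ 2 - u s ^+ 2))
    (fun s st => let: And3 e _ _ := red s (bdd s st) in e).
  apply: (@gronwall_gt0 _ f (fun s => - b s * f s) (fun s => - b s) M 0 t t0).
  - by move=> s /bdd; exact: fd.
  - by move=> s /bM; rewrite normrN.
  - by [].
  - by rewrite f0.
have conserved g t : (forall s, time_interval T s -> is_derive s 1 g (b s * g s)) ->
    time_interval T t -> g t = g 0 * (f t)^-1.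
  move=> gd It; have t0 : 0 <= t by case: It.
  have : g 0 * f 0 = g t * f t.
    apply: (is_derive_0_eq (f := fun s => g s * f s) t0) => s /andP[s0 st].
    have Is : time_interval T s := time_interval_le It s0 st.
    have gs := gd s Is; have fs := fd s Is; derive_pointwise; ring.
  by rewrite f0 mulr1 => ->; rewrite mulfK// gt_eqF ?fgt0.
pose y t := (Num.sqrt (f t))^-1.
have y2 t : time_interval T t -> y t ^+ 2 = (f t)^-1.
  by move=> /fgt0 ft; rewrite /y exprVn sqr_sqrtr// ltW.
have ygt0 t : time_interval T t -> 0 < y t.
  by move=> /fgt0 ft; rewrite /y invr_gt0 sqrtr_gt0.
have yd t : time_interval T t -> is_derive t 1 y (2^-1 * (b t * y t)).
  move=> It; have ft := fgt0 t It.
  have sf : 0 < Num.sqrt (f t) by rewrite sqrtr_gt0.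
  have := is_derive_invf (f := fun s => Num.sqrt (f s)) (lt0r_neq0 sf)
    (is_derive_sqrtf ft (fd t It)).
  move/is_derive_eq; apply; rewrite /y.
  have fE := sqr_sqrtr (ltW ft); rewrite -[in X in - b t * X]fE.
  by field; rewrite gt_eqF.
have pE t : time_interval T t -> p t = p 0 * y t ^+ 2.
  by move=> It; rewrite y2//; apply: conserved => // s /red[].
have uE t : time_interval T t -> u t = u 0 * y t ^+ 2.
  by move=> It; rewrite y2//; apply: conserved => // s /red[].
exists y, (fun t => b t * y t); split; last first.
  by move=> t It; rewrite pE// uE// mulfK// gt_eqF ?ygt0.
split=> //.
- by rewrite /y f0 sqrtr1 invr1.
- move=> t It; have [bd _ _] := red t It; have yt := yd t It.
  by derive_pointwise; rewrite pE// uE// /E; field.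
- move=> t It; have fy : q^-1 * (p t ^+ 2 - u t ^+ 2 - 9 * b t ^+ 2) * y t ^+ 2 = 1.
    by rewrite -/(f t) y2// mulfV// gt_eqF ?fgt0.
  have {}fy : (p t ^+ 2 - u t ^+ 2 - 9 * b t ^+ 2) * y t ^+ 2 = q.
    by apply: (mulfI (invr_neq0 q0)); rewrite mulrA fy mulVf.
  by rewrite -[in RHS]fy pE// uE// /E; ring.
Qed.

(** While the amplitude stays in a compact subset of the positive half-line, the
    energy integral bounds [v], so [b], [p] and [u] are bounded and the solution
    could be continued. *)
Lemma amplitude_unbounded (T : R) b p u (E q : R) y v (t2 e M : R) :
  reduced_flow T%:E b p u -> reduced_maximal T%:E b p u ->
  amplitude_flow T%:E E q y v ->
  (forall t, time_interval T%:E t ->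
    [/\ p t = p 0 * y t ^+ 2, u t = u 0 * y t ^+ 2 & b t = v t / y t]) ->
  time_interval T%:E t2 -> 0 < e ->
  exists t, [/\ time_interval T%:E t, t2 <= t & (y t < e) || (M < y t)].
Proof.
move=> red max amp rep It2 e0; apply: contrapT => /forallNP bounded_y.
have T0 : 0 < T by have := amplitude_T_gt0 amp; rewrite lte_fin.
have yeM t : time_interval T%:E t -> t2 <= t -> e <= y t /\ y t <= M.
  move=> It t2t; split; rewrite leNgt; apply/negP => yt; apply: (bounded_y t).
    by split=> //; rewrite yt.
  by split=> //; rewrite yt orbT.
have I2 t : 0 <= t <= t2 -> time_interval T%:E t.
  by move=> /andP[t0 tt2]; exact: time_interval_le It2 t0 tt2.
have [A [A0 bA]] := is_derive_bounded (f := b) (df := fun s =>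
  - 2^-1 * b s ^+ 2 + 6^-1 * (p s ^+ 2 - u s ^+ 2))
  (fun s st => let: And3 d _ _ := red s (I2 s st) in d).
have [B [B0 pB]] := is_derive_bounded (f := p) (df := fun s => b s * p s)
  (fun s st => let: And3 _ d _ := red s (I2 s st) in d).
have [C [C0 uC]] := is_derive_bounded (f := u) (df := fun s => b s * u s)
  (fun s st => let: And3 _ _ d := red s (I2 s st) in d).
pose V := `|E| * M ^+ 6 + `|q| + 1.
pose K := A + B + C + `|p 0| * M ^+ 2 + `|u 0| * M ^+ 2 + V / e.
have M0 : 0 <= M by have [eM yM] := yeM t2 It2 (lexx _); apply: le_trans yM; apply: le_trans eM; exact: ltW.
have V0 : 0 <= V by rewrite !addr_ge0// mulr_ge0// exprn_ge0.
have Ve : 0 <= V / e by rewrite divr_ge0// ltW.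
have pM : 0 <= `|p 0| * M ^+ 2 by rewrite mulr_ge0// exprn_ge0.
have uM : 0 <= `|u 0| * M ^+ 2 by rewrite mulr_ge0// exprn_ge0.
apply: (reduced_maximal_unbounded T0 red max (M := K)) => t It.
have t0 : 0 <= t by case: It.
have [tt2|/ltW t2t] := leP t t2.
  have tI : 0 <= t <= t2 by rewrite t0.
  have := bA t tI; have := pB t tI; have := uC t tI.
  by move=> ? ? ?; split; rewrite /K; lra.
have [ye yM] := yeM t It t2t; have y0 := amplitude_gt0 amp It.
have yX n : y t ^+ n <= M ^+ n by rewrite lerXn2r// nnegrE ltW.
have yX0 n : 0 <= y t ^+ n by rewrite exprn_ge0// ltW.
have [-> -> ->] := rep t It.
have vV : `|v t| <= V.
  have en := amplitude_energy amp It.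
  have h1 : E * y t ^+ 6 <= `|E| * M ^+ 6.
    apply: le_trans (_ : `|E| * y t ^+ 6 <= _).
      by rewrite ler_wpM2r// ler_norm.
    by rewrite ler_wpM2l.
  have h2 : - q <= `|q| by rewrite -normrN ler_norm.
  have h3 := sqr_ge0 (`|v t| - 1).
  have h4 := real_normK (num_real (v t)).
  have h5 := normr_ge0 (v t).
  have {}h3 : 2 * `|v t| <= `|v t| ^+ 2 + 1 by rewrite sqrrB1 in h3; lra.
  have h6 : 0 <= `|E| * M ^+ 6 by rewrite mulr_ge0// exprn_ge0.
  have h7 := normr_ge0 q.
  by rewrite /V; rewrite h4 in h3; lra.
split.
- rewrite normrM normfV (gtr0_norm y0).
  apply: (@le_trans _ _ (V / e)); last by rewrite /K; lra.
  by apply: ler_pM; rewrite ?invr_ge0 ?(ltW y0)// lef_pV2.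
- rewrite normrM (ger0_norm (yX0 2%N)); apply: (@le_trans _ _ (`|p 0| * M ^+ 2)).
    by rewrite ler_wpM2l.
  by rewrite /K; lra.
- rewrite normrM (ger0_norm (yX0 2%N)); apply: (@le_trans _ _ (`|u 0| * M ^+ 2)).
    by rewrite ler_wpM2l.
  by rewrite /K; lra.
Qed.

End Amplitude.

(** * Collapse and growth of the amplitude *)

Section FiniteTime.
Variable R : realType.

Lemma time_interval_bounded (T : \bar R) (B : R) :
  (forall t, time_interval T t -> t <= B) -> (0 < T)%E -> (T < +oo)%E.
Proof.
case: T => [T||] bnd //= _; first exact: ltry.
have B1 : `|B| + 1 <= B by apply: bnd; split; [exact: addr_ge0 | exact: ltry].
by exfalso; have := ler_norm B; lra.
Qed.

Lemma near_time_interval_end (T t2 : R) : 0 <= t2 -> t2 < T ->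
  \forall t \near T^'-, time_interval T%:E t /\ t2 <= t.
Proof.
move=> t20 t2T; near=> t.
have t2t : t2 <= t by apply: ltW; near: t; exact: nbhs_left_gt.
split=> //; split; first exact: le_trans t2t.
by rewrite lte_fin; near: t; exact: nbhs_left_lt.
Unshelve. all: by end_near. Qed.

End FiniteTime.

Section AmplitudeAsymptotics.
Variables (R : realType) (T : \bar R) (E q : R) (y v : R -> R).
Hypothesis amp : amplitude_flow T E q y v.

(** What maximality says about the amplitude, by [amplitude_unbounded]. *)
Definition escaping := forall T0 : R, T = T0%:E -> forall t2 e M : R,
  time_interval T t2 -> 0 < e ->
  exists t, [/\ time_interval T t, t2 <= t & (y t < e) || (M < y t)].

Hypothesis esc : escaping.

Local Notation I := (time_interval T).

Let T0 : (0 < T)%E := amplitude_T_gt0 amp.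
Let I0 : I 0 := time_interval0 T0.
Let ygt0 t : I t -> 0 < y t := @amplitude_gt0 _ _ _ _ _ _ amp t.

Let sub s t r : I t -> I s -> s <= r <= t -> I r.
Proof.
move=> It [s0 _] /andP[sr rt]; apply: time_interval_le It _ rt.
exact: le_trans sr.
Qed.

Let finite_T : (T < +oo)%E -> exists2 T1 : R, T = T1%:E & 0 < T1.
Proof. by case: T T0 => [T1||]//; rewrite lte_fin; exists T1. Qed.

Let y_nonincr s t : I s -> I t -> s <= t -> (forall r, s <= r <= t -> v r <= 0) ->
  y t <= y s.
Proof.
move=> Is It st v0; apply: (is_derive_le0_ge st) => r.
  by move=> /(sub It Is); exact: (amplitude_y amp).
by move=> /andP[sr rt]; rewrite pmulr_rle0 ?invr_gt0// v0// (ltW sr) (ltW rt).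
Qed.

Let y_nondecr s t : I s -> I t -> s <= t -> (forall r, s <= r <= t -> 0 <= v r) ->
  y s <= y t.
Proof.
move=> Is It st v0; apply: (is_derive_ge0_le st) => r.
  by move=> /(sub It Is); exact: (amplitude_y amp).
by move=> /andP[sr rt]; rewrite pmulr_rge0 ?invr_gt0// v0// (ltW sr) (ltW rt).
Qed.

Let v_nonincr s t : E <= 0 -> I s -> I t -> s <= t -> v t <= v s.
Proof.
move=> E0 Is It st; apply: (is_derive_le0_ge st) => r.
  by move=> /(sub It Is); exact: (amplitude_v amp).
move=> /andP[sr rt]; rewrite mulr_le0_ge0//; first by rewrite pmulr_rle0 ?invr_gt0.
by rewrite exprn_ge0// ltW// ygt0//; apply: sub It Is _; rewrite !ltW.
Qed.

Let v_nondecr s t : 0 <= E -> I s -> I t -> s <= t -> v s <= v t.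
Proof.
move=> E0 Is It st; apply: (is_derive_ge0_le st) => r.
  by move=> /(sub It Is); exact: (amplitude_v amp).
move=> /andP[sr rt]; rewrite mulr_ge0//; first by rewrite pmulr_rge0 ?invr_gt0.
by rewrite exprn_ge0// ltW// ygt0//; apply: sub It Is _; rewrite !ltW.
Qed.

Let sqr_le (a c : R) : 0 <= a -> 0 <= c -> a ^+ 2 <= c ^+ 2 -> a <= c.
Proof. by move=> a0 c0; rewrite ler_pXn2r. Qed.

(** For [0 <= E] the energy integral keeps [v] away from zero. For [E < 0] the
    oscillator is pulled towards zero: were [v] to stay nonnegative, it would
    decrease at least linearly while the energy integral bounds [y]. *)
Lemma collapse_velocity : q < 0 -> (0 <= E -> v 0 < 0) ->
  exists t2 k, [/\ I t2, 0 < k & forall t, I t -> t2 <= t -> v t <= - k].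
Proof.
move=> q0 v0; have [E0|E0] := leP 0 E.
  have {}v0 := v0 E0.
  have vneq0 t : I t -> v t != 0.
    move=> It; apply/eqP => vt; have := amplitude_energy amp It.
    rewrite vt expr0n mulr0 => en; have : 0 <= E * y t ^+ 6.
      by rewrite mulr_ge0// exprn_ge0// ltW// ygt0.
    by lra.
  have vlt0 t : I t -> v t < 0.
    move=> It; rewrite ltNge; apply/negP => vt; have t0 : 0 <= t by case: It.
    have [|||z [z0 zt vz _]] := @first_zero _ (fun s => - v s) 0 t t0.
    - move=> s /(sub It I0) Is; apply: is_derive_continuousf.
      exact: is_derive_oppf (amplitude_v amp Is).
    - by rewrite oppr_gt0.
    - by rewrite oppr_le0.
    have Iz : I z by apply: (sub It I0); rewrite (ltW z0).
    by have /eqP := vneq0 z Iz; apply; apply/eqP; rewrite -oppr_eq0 vz.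
  have sq : 0 < Num.sqrt (- q) by rewrite sqrtr_gt0 oppr_gt0.
  exists 0, (Num.sqrt (- q) / 3); split=> [//||t It _]; first by rewrite divr_gt0.
  rewrite lerNr; apply: sqr_le.
  - by rewrite divr_ge0// ltW.
  - by rewrite oppr_ge0 ltW// vlt0.
  rewrite expr_div_n sqr_sqrtr ?oppr_ge0 ?(ltW q0)// sqrrN.
  have := amplitude_energy amp It; have : 0 <= E * y t ^+ 6.
    by rewrite mulr_ge0// exprn_ge0// ltW// ygt0.
  by lra.
suff [t2 It2 vt2] : exists2 t2, I t2 & v t2 < 0.
  exists t2, (- v t2); split=> // [|t It t2t]; first by rewrite oppr_gt0.
  by rewrite opprK; apply: v_nonincr => //; exact: ltW.
apply: contrapT => nv.
have vge0 t : I t -> 0 <= v t.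
  by move=> It; rewrite leNgt; apply/negP => vt; apply: nv; exists t.
have y1 t : I t -> 1 <= y t.
  move=> It; rewrite -(amplitude_init amp); apply: y_nondecr => //; first by case: It.
  by move=> r /(sub It I0); exact: vge0.
have Tfin : (T < +oo)%E.
  apply: (@time_interval_bounded _ _ (6 * v 0 / - E)) T0 => t It.
  have t0 : 0 <= t by case: It.
  have : v t <= v 0 + 6^-1 * E * (t - 0).
    apply: (is_derive_le_growth t0) => r.
      by move=> /(sub It I0); exact: (amplitude_v amp).
    move=> /andP[r0 rt]; have Ir : I r by apply: (sub It I0); rewrite !ltW.
    have c0 : 6^-1 * E <= 0 by rewrite pmulr_rle0 ?invr_gt0// ltW.
    by rewrite -[leRHS]mulr1 (ler_wnM2l c0)// exprn_ege1// y1.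
  rewrite subr0 ler_pdivlMr ?oppr_gt0//; have := vge0 t It.
  by lra.
have [T1 TE _] := finite_T Tfin.
have [t [It _ /orP[yt|yt]]] := esc TE (q / E) I0 ltr01.
  by have := y1 t It; rewrite leNgt yt.
have yE : y t <= y t ^+ 6 by apply: ler_eXnr; rewrite ?y1.
have y6 : y t ^+ 6 <= q / E.
  rewrite ler_ndivlMr//; have := amplitude_energy amp It; have := sqr_ge0 (v t).
  by lra.
by have := le_trans yE y6; rewrite leNgt yt.
Qed.

(** Once [v <= - k] the amplitude decreases at least linearly, so time is finite;
    as the amplitude is bounded it can only escape to zero. *)
Lemma amplitude_collapse : q < 0 -> (0 <= E -> v 0 < 0) ->
  (T < +oo)%E /\ exists k, [/\ 0 < k,
    \forall t \near (fine T)^'-, v t <= - k & y t @[t --> (fine T)^'-] --> 0].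
Proof.
move=> q0 v0; have [t2 [k [It2 k0 vk]]] := collapse_velocity q0 v0.
have t20 : 0 <= t2 by case: It2.
have yt2 t : I t -> t2 <= t -> y t <= y t2 + 2^-1 * - k * (t - t2).
  move=> It t2t; apply: (is_derive_le_growth t2t) => r.
    by move=> /(sub It It2); exact: (amplitude_y amp).
  move=> /andP[r2 rt]; rewrite ler_pM2l ?invr_gt0//; apply: vk; last exact: ltW.
  by apply: (sub It It2); rewrite !ltW.
have Tfin : (T < +oo)%E.
  apply: (@time_interval_bounded _ _ (t2 + 2 * y t2 / k)) T0 => t It.
  have [tt2|/ltW t2t] := leP t t2.
    by apply: le_trans tt2 _; rewrite lerDl divr_ge0// ?(ltW k0)// mulr_ge0// ltW// ygt0.
  rewrite -lerBlDl ler_pdivlMr//.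
  by have := yt2 t It t2t; have := ygt0 It; lra.
split=> //; have [T1 TE T10] := finite_T Tfin.
have mono s t : I s -> I t -> t2 <= s -> s <= t -> y t <= y s.
  move=> Is It t2s st; apply: y_nonincr => // r /andP[sr rt].
  apply: le_trans (_ : - k <= 0); last by rewrite oppr_le0 ltW.
  by apply: vk; [apply: (sub It Is); rewrite sr | exact: le_trans sr].
have end_ s : I s -> \forall t \near (fine T)^'-, I t /\ s <= t.
  move=> [s0]; rewrite TE lte_fin => sT.
  exact: near_time_interval_end.
exists k; split=> //.
  by move: (end_ _ It2); apply: filterS => t [It t2t]; exact: vk.
apply/cvgr0Pnorm_lt => e e0.
have [s [Is t2s /orP[ys|]]] := esc TE (y t2) It2 e0; last first.
  by rewrite ltNge (mono t2 s).
move: (end_ _ Is); apply: filterS => t [It st].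
by rewrite gtr0_norm ?ygt0//; apply: le_lt_trans ys; exact: mono.
Qed.

(** For [q < 0] and [0 < v 0] the energy integral gives the bound at once. For
    [0 < q] it keeps [y] away from zero, so [v] increases at least linearly and
    becomes positive; from then on [v / y ^+ 3] increases. *)
Lemma growth_velocity : 0 < E -> q != 0 -> (q < 0 -> 0 < v 0) ->
  exists t2 k, [/\ I t2, 0 < k & forall t, I t -> t2 <= t -> k * y t ^+ 3 <= v t].
Proof.
move=> E0 qneq0 v0.
have y30 t : I t -> 0 <= y t ^+ 3 by move=> It; rewrite exprn_ge0// ltW// ygt0.
have [q0|q0|q0] := ltgtP q 0; last by rewrite q0 eqxx in qneq0.
  exists 0, (Num.sqrt E / 3); split=> [//||t It _]; first by rewrite divr_gt0// sqrtr_gt0.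
  have vt : 0 < v t.
    by apply: lt_le_trans (v0 q0) _; apply: v_nondecr; rewrite ?(ltW E0)//; case: It.
  apply: sqr_le; rewrite ?(ltW vt)//.
    by rewrite mulr_ge0 ?y30// divr_ge0// sqrtr_ge0.
  rewrite exprMn expr_div_n sqr_sqrtr ?(ltW E0)// -exprM.
  by have := amplitude_energy amp It; lra.
suff [t2 It2 vt2] : exists2 t2, I t2 & 0 < v t2.
  have vpos t : I t -> t2 <= t -> 0 < v t.
    by move=> It t2t; apply: lt_le_trans vt2 _; apply: v_nondecr => //; exact: ltW.
  have y2 := ygt0 It2.
  exists t2, (v t2 / y t2 ^+ 3); split=> [//||t It t2t].
    by rewrite divr_gt0// exprn_gt0.
  have yt := ygt0 It.
  have y2t : y t2 <= y t.
    apply: y_nondecr => // r /andP[t2r rt]; apply/ltW/vpos => //.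
    by apply: (sub It It2); rewrite t2r.
  have y6 : y t2 ^+ 6 <= y t ^+ 6 by rewrite lerXn2r// nnegrE ltW.
  apply: sqr_le; last first.
  - rewrite exprMn expr_div_n -!exprM mulrAC ler_pdivrMr ?exprn_gt0//.
    have e1 := amplitude_energy amp It; have e2 := amplitude_energy amp It2.
    have : q * y t2 ^+ 6 <= q * y t ^+ 6 by rewrite ler_pM2l.
    have -> : v t ^+ 2 = 9^-1 * (E * y t ^+ 6 - q) by rewrite -e1; field.
    have -> : v t2 ^+ 2 = 9^-1 * (E * y t2 ^+ 6 - q) by rewrite -e2; field.
    by lra.
  - exact/ltW/vpos.
  - by rewrite mulr_ge0 ?y30// divr_ge0// ltW// exprn_gt0.
apply: contrapT => nv.
have vle0 t : I t -> v t <= 0.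
  by move=> It; rewrite leNgt; apply/negP => vt; apply: nv; exists t.
have y1 t : I t -> y t <= 1.
  move=> It; rewrite -(amplitude_init amp); apply: y_nonincr => //; first by case: It.
  by move=> r /(sub It I0); exact: vle0.
have qE0 : 0 < q / E by rewrite divr_gt0.
have yqE t : I t -> q / E <= y t.
  move=> It; have yt := ygt0 It.
  apply: (@le_trans _ _ (y t ^+ 6)); last first.
    by apply: ler_iXnr; rewrite ?(ltW yt) ?y1.
  rewrite ler_pdivrMr//; have := amplitude_energy amp It.
  by have := sqr_ge0 (v t); lra.
pose c := 6^-1 * E * (q / E) ^+ 5.
have c0 : 0 < c by rewrite mulr_gt0 ?exprn_gt0// mulr_gt0// invr_gt0.
have Tfin : (T < +oo)%E.
  apply: (@time_interval_bounded _ _ (- v 0 / c)) T0 => t It.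
  have t0 : 0 <= t by case: It.
  have : v 0 + c * (t - 0) <= v t.
    apply: (is_derive_ge_growth t0) => r.
      by move=> /(sub It I0); exact: (amplitude_v amp).
    move=> /andP[r0 rt]; have Ir : I r by apply: (sub It I0); rewrite !ltW.
    rewrite ler_wpM2l//; first by rewrite mulr_ge0// ltW// invr_gt0.
    by rewrite lerXn2r// ?nnegrE ?yqE// ltW// ygt0.
  by rewrite subr0 ler_pdivlMr//; have := vle0 t It; lra.
have [T1 TE _] := finite_T Tfin.
have [t [It _ /orP[yt|yt]]] := esc TE 1 I0 qE0.
  by have := yqE t It; rewrite leNgt yt.
by have := y1 t It; rewrite leNgt yt.
Qed.

(** The inverse square of the amplitude decreases at least linearly. *)
Lemma amplitude_growth : 0 < E -> q != 0 -> (q < 0 -> 0 < v 0) ->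
  [/\ (T < +oo)%E, y t @[t --> (fine T)^'-] --> +oo &
    v t / y t ^+ 3 @[t --> (fine T)^'-] --> Num.sqrt E / 3].
Proof.
move=> E0 q0 v0; have [t2 [k [It2 k0 vk]]] := growth_velocity E0 q0 v0.
have t20 : 0 <= t2 by case: It2.
have yt2 t : I t -> t2 <= t -> (y t ^+ 2)^-1 <= (y t2 ^+ 2)^-1 + - k * (t - t2).
  move=> It t2t.
  apply: (is_derive_le_growth (f := fun s => (y s ^+ 2)^-1)
    (df := fun s => - ((y s ^+ 2) ^+ 2)^-1 * (2%:R * y s ^+ 1 * (2^-1 * v s))) t2t) => r.
    move=> /(sub It It2) Ir; apply: (is_derive_invf (f := fun s => y s ^+ 2)).
      by rewrite expf_neq0// gt_eqF ?ygt0.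
    exact: is_derive_expf (amplitude_y amp Ir).
  move=> /andP[r2 rt]; have Ir : I r by apply: (sub It It2); rewrite !ltW.
  have yr := ygt0 Ir; have := vk r Ir (ltW r2).
  rewrite -ler_pdivlMr ?exprn_gt0// => kv.
  have -> : - ((y r ^+ 2) ^+ 2)^-1 * (2%:R * y r ^+ 1 * (2^-1 * v r)) = - (v r / y r ^+ 3).
    by field; rewrite gt_eqF.
  by rewrite lerN2.
have Tfin : (T < +oo)%E.
  apply: (@time_interval_bounded _ _ (t2 + (y t2 ^+ 2)^-1 / k)) T0 => t It.
  have [tt2|/ltW t2t] := leP t t2.
    apply: le_trans tt2 _; rewrite lerDl divr_ge0// ?(ltW k0)// invr_ge0.
    exact: sqr_ge0.
  rewrite -lerBlDl ler_pdivlMr//.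
  have : 0 < (y t ^+ 2)^-1 by rewrite invr_gt0 exprn_gt0// ygt0.
  by have := yt2 t It t2t; lra.
have [T1 TE T10] := finite_T Tfin.
have vpos t : I t -> t2 <= t -> 0 < v t.
  move=> It t2t; apply: lt_le_trans (vk t It t2t).
  by rewrite mulr_gt0// exprn_gt0// ygt0.
have mono s t : I s -> I t -> t2 <= s -> s <= t -> y s <= y t.
  move=> Is It t2s st; apply: y_nondecr => // r /andP[sr rt].
  by apply/ltW/vpos; [apply: (sub It Is); rewrite sr | exact: le_trans sr].
have end_ s : I s -> \forall t \near (fine T)^'-, I t /\ s <= t.
  move=> [s0]; rewrite TE lte_fin => sT.
  exact: near_time_interval_end.
have yoo : y t @[t --> (fine T)^'-] --> +oo.
  apply/cvgryPge => A.
  have [s [Is t2s /orP[|ys]]] := esc TE A It2 (ygt0 It2).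
    by rewrite ltNge (mono t2 s).
  move: (end_ _ Is); apply: filterS => t [It st].
  by apply: ltW; apply: lt_le_trans ys _; exact: mono.
split=> //.
have yV : (y t)^-1 @[t --> (fine T)^'-] --> 0.
  apply/gtr0_cvgV0 => //.
  by move: (end_ _ It2); apply: filterS => t [It t2t]; exact: ygt0.
have -> : Num.sqrt E / 3 = Num.sqrt (9^-1 * (E - q * 0 ^+ 6)).
  rewrite expr0n mulr0 subr0 mulrC sqrtrM ?invr_ge0//; congr (_ * _).
  have -> : (9^-1 : R) = 3^-1 ^+ 2 by field.
  by rewrite sqrtr_sqr ger0_norm ?invr_ge0.
apply: (@cvg_trans _ ((Num.sqrt (9^-1 * (E - q * (y t)^-1 ^+ 6))) @[t --> (fine T)^'-])).
  apply: near_eq_cvg; move: (end_ _ It2); apply: filterS => t [It t2t].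
  have yt := ygt0 It; have vt := vpos t It t2t.
  have -> : 9^-1 * (E - q * (y t)^-1 ^+ 6) = (v t / y t ^+ 3) ^+ 2.
    have en := amplitude_energy amp It.
    have -> : E = (9 * v t ^+ 2 + q) / y t ^+ 6.
      by rewrite en subrK mulfK// expf_neq0// gt_eqF.
    by field; rewrite gt_eqF.
  by rewrite sqrtr_sqr gtr0_norm// divr_gt0// exprn_gt0.
apply: continuous_cvg; first exact: sqrt_continuous.
apply: cvgM; first exact: cvg_cst.
apply: cvgB; first exact: cvg_cst.
apply: cvgM; first exact: cvg_cst.
exact: (cvg_comp _ _ yV (@exprn_continuous R 6 0)).
Qed.

End AmplitudeAsymptotics.

(** * Limits of the shape parameters *)

Section ShapeLimits.
Variables (R : realType) (F : set_system R).
Context {FF : ProperFilter F}.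
Variables (p0 u0 : R) (y v b p u : R -> R).

Local Notation stretched t :=
  [/\ 0 < y t, p t = p0 * y t ^+ 2, u t = u0 * y t ^+ 2 & b t = v t / y t].

Hypothesis rep : \forall t \near F, stretched t.

Local Notation l t := (2^-1 * (p t - b t)).

(** With [X = v / y ^+ 3], the shape parameters are [2 * X / (p0 - X)] and
    [u0 / (p0 - X)]. *)
Lemma growth_limits (x : R) : x < p0 ->
  y t @[t --> F] --> +oo -> v t / y t ^+ 3 @[t --> F] --> x ->
  [/\ b t / l t @[t --> F] --> 2 * x / (p0 - x),
      u t / (2 * l t) @[t --> F] --> u0 / (p0 - x) &
      l t @[t --> F] --> +oo].
Proof.
move=> xp0 yoo Xx; pose X t := v t / y t ^+ 3.
have d0 : 0 < p0 - x by rewrite subr_gt0.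
have cd : p0 - X t @[t --> F] --> p0 - x by apply: cvgB => //; exact: cvg_cst.
have cdV : (p0 - X t)^-1 @[t --> F] --> (p0 - x)^-1 by apply: cvgV; rewrite ?gt_eqF.
have Xd : \forall t \near F, (p0 - x) / 2 < p0 - X t.
  by apply: (cvgr_gt _ cd); rewrite ltr_pdivrMr//; lra.
split.
- apply: (@cvg_trans _ (2 * X t / (p0 - X t) @[t --> F])); last first.
    by apply: cvgM => //; apply: cvgM => //; exact: cvg_cst.
  apply: near_eq_cvg; near=> t.
  have dt : 0 < p0 - X t.
    by apply: lt_trans (_ : (p0 - x) / 2 < _); [rewrite divr_gt0 | near: t].
  have [y0 -> _ ->] : stretched t by near: t.
  have -> : v t / y t = X t * y t ^+ 2 by rewrite /X; field; rewrite gt_eqF.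
  have -> : 2^-1 * (p0 * y t ^+ 2 - X t * y t ^+ 2) = 2^-1 * (p0 - X t) * y t ^+ 2.
    by ring.
  by field; rewrite !gt_eqF.
- apply: (@cvg_trans _ (u0 / (p0 - X t) @[t --> F])); last first.
    by apply: cvgM => //; exact: cvg_cst.
  apply: near_eq_cvg; near=> t.
  have dt : 0 < p0 - X t.
    by apply: lt_trans (_ : (p0 - x) / 2 < _); [rewrite divr_gt0 | near: t].
  have [y0 -> -> ->] : stretched t by near: t.
  have -> : v t / y t = X t * y t ^+ 2 by rewrite /X; field; rewrite gt_eqF.
  have -> : 2^-1 * (p0 * y t ^+ 2 - X t * y t ^+ 2) = 2^-1 * (p0 - X t) * y t ^+ 2.
    by ring.
  by field; rewrite !gt_eqF.
- apply/cvgryPge => A; near=> t.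
  have dt : (p0 - x) / 2 < p0 - X t by near: t.
  have [y0 -> _ ->] : stretched t by near: t.
  have y3 : y t ^+ 3 != 0 by rewrite expf_neq0// gt_eqF.
  have -> : 2^-1 * (p0 * y t ^+ 2 - v t / y t) = 2^-1 * (p0 - X t) * y t ^+ 2.
    by rewrite /X; field; rewrite gt_eqF.
  have yA : 1 + 4 * `|A| / (p0 - x) <= y t.
    by near: t; move/cvgryPge: yoo; exact.
  have A0 : 0 <= 4 * `|A| / (p0 - x) by rewrite divr_ge0 ?mulr_ge0// ltW.
  have yy : 4 * `|A| / (p0 - x) <= y t ^+ 2.
    apply: le_trans (_ : y t <= _); first by lra.
    by rewrite expr2 ler_peMl// ?(ltW y0)//; lra.
  apply: le_trans (ler_norm A) _.
  move: yy; rewrite ler_pdivrMr// => yy.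
  have : 2^-1 * ((p0 - x) / 2) * y t ^+ 2 <= 2^-1 * (p0 - X t) * y t ^+ 2.
    by rewrite ler_wpM2r ?sqr_ge0// ler_pM2l ?invr_gt0// ltW.
  by lra.
Unshelve. all: by end_near. Qed.

(** With [Z = y ^+ 3 / v], which tends to zero, the shape parameters are
    [2 / (p0 * Z - 1)] and [u0 * Z / (p0 * Z - 1)]. *)
Lemma collapse_limits (k : R) : 0 < k ->
  (\forall t \near F, v t <= - k) -> y t @[t --> F] --> 0 ->
  [/\ b t / l t @[t --> F] --> (- 2 : R),
      u t / (2 * l t) @[t --> F] --> (0 : R) &
      l t @[t --> F] --> +oo].
Proof.
move=> k0 vk y0lim; pose Z t := y t ^+ 3 / v t.
have Z0 : Z t @[t --> F] --> (0 : R).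
  apply/cvgr0Pnorm_lt => e e0; near=> t.
  have [yt _ _ _] : stretched t by near: t.
  have vt : v t <= - k by near: t.
  have y1 : y t < 1 by near: t; exact: (cvgr_lt _ y0lim).
  have yk : y t < e * k by near: t; apply: (cvgr_lt _ y0lim); exact: mulr_gt0.
  have v0 : v t < 0 by apply: le_lt_trans vt _; rewrite oppr_lt0.
  rewrite /Z normrM normfV (ltr0_norm v0) gtr0_norm ?exprn_gt0//.
  rewrite ltr_pdivrMr ?oppr_gt0//.
  apply: (@le_lt_trans _ _ (y t)).
    by apply: ler_iXnr => //; rewrite ltW.
  apply: lt_le_trans yk _; rewrite ler_pM2l// lerNr.
  exact: vt.
have cd : p0 * Z t - 1 @[t --> F] --> (-1 : R).
  have : p0 * Z t - 1 @[t --> F] --> p0 * 0 - 1.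
    by apply: cvgB; [apply: cvgM => //; exact: cvg_cst | exact: cvg_cst].
  by rewrite mulr0 sub0r.
have cdV : (p0 * Z t - 1)^-1 @[t --> F] --> (-1 : R).
  by rewrite -[X in _ --> X]invrN1; apply: cvgV => //; rewrite oppr_eq0 oner_eq0.
have Zd : \forall t \near F, p0 * Z t - 1 < 0 by apply: (cvgr_lt _ cd).
split.
- rewrite -[- 2]mulrN1.
  apply: (@cvg_trans _ (2 / (p0 * Z t - 1) @[t --> F])); last first.
    by apply: cvgM => //; exact: cvg_cst.
  apply: near_eq_cvg; near=> t.
  have dt : p0 * Z t - 1 < 0 by near: t.
  have [yt -> _ ->] : stretched t by near: t.
  have vt : v t < 0.
    by apply: le_lt_trans (_ : - k < 0); [near: t | rewrite oppr_lt0].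
  have -> : y t ^+ 2 = Z t * (v t / y t).
    by rewrite /Z; field; rewrite (gt_eqF yt) (lt_eqF vt).
  have -> : 2^-1 * (p0 * (Z t * (v t / y t)) - v t / y t) =
      2^-1 * (p0 * Z t - 1) * (v t / y t) by ring.
  by field; rewrite (gt_eqF yt) (lt_eqF vt) (lt_eqF dt).
- rewrite (_ : 0 = u0 * 0 * - 1); last by rewrite mulr0 mul0r.
  apply: (@cvg_trans _ (u0 * Z t / (p0 * Z t - 1) @[t --> F])); last first.
    by apply: cvgM => //; apply: cvgM => //; exact: cvg_cst.
  apply: near_eq_cvg; near=> t.
  have dt : p0 * Z t - 1 < 0 by near: t.
  have [yt -> -> ->] : stretched t by near: t.
  have vt : v t < 0.
    by apply: le_lt_trans (_ : - k < 0); [near: t | rewrite oppr_lt0].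
  have -> : y t ^+ 2 = Z t * (v t / y t).
    by rewrite /Z; field; rewrite (gt_eqF yt) (lt_eqF vt).
  have -> : 2^-1 * (p0 * (Z t * (v t / y t)) - v t / y t) =
      2^-1 * (p0 * Z t - 1) * (v t / y t) by ring.
  by field; rewrite (gt_eqF yt) (lt_eqF vt) (lt_eqF dt).
- apply/cvgryPge => A; pose B := 2 * `|A| + `|p0| + 1.
  have B0 : 0 < B by rewrite /B; have := normr_ge0 A; have := normr_ge0 p0; lra.
  near=> t.
  have [yt -> _ ->] : stretched t by near: t.
  have vt : v t <= - k by near: t.
  have y1 : y t < 1 by near: t; exact: (cvgr_lt _ y0lim).
  have yk : y t < k / B by near: t; apply: (cvgr_lt _ y0lim); exact: divr_gt0.
  have y2 : y t ^+ 2 <= 1 by rewrite expr_le1// ?(ltW yt)// ltW.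
  have h1 : - `|p0| <= p0 * y t ^+ 2.
    rewrite lerNl -mulNr; apply: le_trans (_ : `|p0| * y t ^+ 2 <= _).
      by rewrite ler_wpM2r ?sqr_ge0// -normrN ler_norm.
    by rewrite ler_piMr.
  have h2 : B <= - (v t / y t).
    rewrite -mulNr ler_pdivlMr//; move: yk; rewrite ltr_pdivlMr// => yB.
    by move: yB; rewrite mulrC; lra.
  apply: le_trans (ler_norm A) _.
  by rewrite /B in h2; lra.
Unshelve. all: by end_near. Qed.

End ShapeLimits.

(** * Shape parameters of a reduced solution *)

Section ShapeParameters.
Variable R : realType.

Lemma strain_of_reduced (r l : R) : strain_of r l = reduced_strain (r * l) ((r + 2) * l).
Proof.
rewrite /strain_of /reduced_strain; congr diag_mx; apply/rowP => j; rewrite !mxE.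
by case: j => [[|[|[|//]]] hj] /=; field.
Qed.

Lemma vorticity_of_reduced (k l : R) : vorticity_of k l = reduced_vorticity (2 * k * l).
Proof. by []. Qed.

Section ReducedFlow.
Variables (T : \bar R) (b p u : R -> R).
Hypothesis red : reduced_flow T b p u.

Local Notation I := (time_interval T).
Let l t : R := 2^-1 * (p t - b t).
Let r t : R := b t / l t.
Let k t : R := u t / (2 * l t).

(** The third strain eigenvalue [l] satisfies [- l * l <= l']. *)
Lemma reduced_flow_eigenvalue_gt0 : 0 < l 0 -> forall t, I t -> 0 < l t.
Proof.
move=> l0 t It; have t0 : 0 <= t by case: It.
have sub s : 0 <= s <= t -> I s.
  by move=> /andP[s0 st]; exact: time_interval_le It s0 st.
have ld s : 0 <= s <= t -> is_derive s 1 l (2^-1 * (b s * p s -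
    (- 2^-1 * b s ^+ 2 + 6^-1 * (p s ^+ 2 - u s ^+ 2)))).
  by move=> /sub/red[bd pd ud]; rewrite /l; derive_pointwise; ring.
have [M [M0 lM]] := is_derive_bounded ld.
apply: (gronwall_gt0 t0 ld (h := fun s => - l s) (K := M)) => // s sI.
  by rewrite normrN; exact: lM.
rewrite -subr_ge0.
have -> : 2^-1 * (b s * p s - (- 2^-1 * b s ^+ 2 + 6^-1 * (p s ^+ 2 - u s ^+ 2)))
    - - l s * l s = 2^-1 * b s ^+ 2 + 6^-1 * p s ^+ 2 + 12^-1 * u s ^+ 2.
  by rewrite /l; field.
by rewrite !addr_ge0// mulr_ge0// ?sqr_ge0// invr_ge0.
Qed.

Hypothesis lgt0 : forall t, I t -> 0 < l t.

Lemma shape_derivatives t : I t ->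
  [/\ is_derive t 1 l (3^-1 * (- 1 + 2 * r t + 2 * r t ^+ 2 + k t ^+ 2) * l t ^+ 2),
      is_derive t 1 r (3^-1 * l t * (2 + 3 * r t - 3 * r t ^+ 2 - 2 * r t ^+ 3
                                      - (r t + 2) * k t ^+ 2)) &
      is_derive t 1 k (3^-1 * l t * (1 + r t - 2 * r t ^+ 2 - k t ^+ 2) * k t)].
Proof.
move=> It; have [bd pd ud] := red It; have lt0 := lgt0 It.
have lneq0 : l t != 0 by rewrite gt_eqF.
have bE : b t = r t * l t by rewrite /r mulfVK.
have uE : u t = 2 * k t * l t by rewrite /k; field.
have pE : p t = (r t + 2) * l t.
  by rewrite mulrDl -bE /l; field.
have ld : is_derive t 1 l (3^-1 * (- 1 + 2 * r t + 2 * r t ^+ 2 + k t ^+ 2) * l t ^+ 2).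
  by rewrite /l; derive_pointwise; rewrite -/(l t) bE pE uE; field.
split=> //.
- have li := is_derive_invf lneq0 ld.
  apply: (is_derive_eq (is_derive_mulf bd li)).
  by rewrite bE pE uE; field.
- have l2 : 2 * l t != 0 by rewrite mulf_neq0// pnatr_eq0.
  have l2d := is_derive_mulf (is_derive_cstf 2 t) ld.
  have li := is_derive_invf (f := fun s => 2 * l s) l2 l2d.
  apply: (is_derive_eq (is_derive_mulf ud li)).
  by rewrite bE uE; field.
Qed.

Lemma shape_C1 :
  [/\ C1_in I r, C1_in I k & C1_in I l] /\
  [/\ forall t, I t -> deriv_in I l t =
        3^-1 * (- 1 + 2 * r t + 2 * r t ^+ 2 + k t ^+ 2) * l t ^+ 2,
      forall t, I t -> deriv_in I r t =
        3^-1 * l t * (2 + 3 * r t - 3 * r t ^+ 2 - 2 * r t ^+ 3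
                      - (r t + 2) * k t ^+ 2) &
      forall t, I t -> deriv_in I k t =
        3^-1 * l t * (1 + r t - 2 * r t ^+ 2 - k t ^+ 2) * k t].
Proof.
have cts (f : R -> R) (t : R) : (exists d, is_derive t 1 f d) -> {for t, continuous f}.
  by move=> [d]; exact: is_derive_continuousf.
have [lC1 lE] := @C1_in_of_is_derive R T _ l l
    (fun t => 3^-1 * (- 1 + 2 * r t + 2 * r t ^+ 2 + k t ^+ 2) * l t ^+ 2)
    (fun _ _ => erefl)
    (fun t It => let: And3 d _ _ := shape_derivatives It in d)
    ltac:(by move=> t /shape_derivatives[ld rd kd]; apply: cts; eexists;
          derive_pointwise; reflexivity).
have [rC1 rE] := @C1_in_of_is_derive R T _ r r
    (fun t => 3^-1 * l t * (2 + 3 * r t - 3 * r t ^+ 2 - 2 * r t ^+ 3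
                            - (r t + 2) * k t ^+ 2))
    (fun _ _ => erefl)
    (fun t It => let: And3 _ d _ := shape_derivatives It in d)
    ltac:(by move=> t /shape_derivatives[ld rd kd]; apply: cts; eexists;
          derive_pointwise; reflexivity).
have [kC1 kE] := @C1_in_of_is_derive R T _ k k
    (fun t => 3^-1 * l t * (1 + r t - 2 * r t ^+ 2 - k t ^+ 2) * k t)
    (fun _ _ => erefl)
    (fun t It => let: And3 _ _ d := shape_derivatives It in d)
    ltac:(by move=> t /shape_derivatives[ld rd kd]; apply: cts; eexists;
          derive_pointwise; reflexivity).
by [].
Qed.

End ReducedFlow.

(** If [u] and [p] agree in size the oscillator is free: [v] is constant and the
    amplitude is affine. *)
Lemma affine_reduced_flow (b0 p0 u0 : R) : 0 <= b0 -> p0 ^+ 2 = u0 ^+ 2 ->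
  let y t := 1 + 2^-1 * b0 * t in
  reduced_flow +oo (fun t => b0 / y t) (fun t => p0 * y t ^+ 2) (fun t => u0 * y t ^+ 2).
Proof.
move=> b00 pu y t [t0 _].
have yt : 0 < y t by rewrite ltr_pwDl// mulr_ge0// mulr_ge0// invr_ge0.
have yd : is_derive t 1 y (2^-1 * b0) by rewrite /y; derive_pointwise; ring.
split.
- have yi := is_derive_invf (lt0r_neq0 yt) yd.
  derive_pointwise.
  have -> : (p0 * y t ^+ 2) ^+ 2 = (u0 * y t ^+ 2) ^+ 2 by rewrite exprMn pu -exprMn.
  by field; rewrite gt_eqF.
- by derive_pointwise; field; rewrite gt_eqF.
- by derive_pointwise; field; rewrite gt_eqF.
Qed.

(** With [s] the square root of [1 - 4 * m ^+ 2], both denominators are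
    proportional to [9 - s ^+ 2]. *)
Lemma infty_values (m s p0 : R) : 0 <= s -> s ^+ 2 = 1 - 4 * m ^+ 2 ->
  Num.sqrt (1 - 4 * m ^+ 2) = s -> p0 != 0 ->
  [/\ 2 * (p0 * s / 3) / (p0 - p0 * s / 3) = r_infty m,
      2 * m * p0 / (p0 - p0 * s / 3) = k_infty m &
      1 + r_infty m - 2 * r_infty m ^+ 2 - k_infty m ^+ 2 = 0].
Proof.
move=> s0 s2 sE p00.
have m2 : m ^+ 2 = (1 - s ^+ 2) / 4 by rewrite s2; field.
have s1 : s <= 1.
  by rewrite -(ler_pXn2r (ltn0Sn 1))// ?nnegrE// expr1n s2; have := sqr_ge0 m; lra.
have ns : 3 - s != 0 by rewrite subr_eq0 gt_eqF//; lra.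
have ps : 3 + s != 0 by rewrite gt_eqF//; lra.
have rE : r_infty m = 2 * s / (3 - s).
  rewrite /r_infty sE m2.
  have -> : 2 * ((1 - s ^+ 2) / 4) + 4 = (3 - s) * (3 + s) / 2 by field.
  by field; rewrite ns ps.
have kE : k_infty m = 6 * m / (3 - s).
  rewrite /k_infty sE m2.
  have -> : 2 * ((1 - s ^+ 2) / 4) + 4 = (3 - s) * (3 + s) / 2 by field.
  by field; rewrite ns ps.
have dE : p0 - p0 * s / 3 = p0 * (3 - s) / 3 by field.
rewrite dE rE kE; split.
- by field; rewrite ns p00.
- by field; rewrite ns p00.
- rewrite !expr_div_n !exprMn m2.
  by field.
Qed.

End ShapeParameters.

(** * The three regimes *)

Section Regimes.
Variables (R : realType) (r0 k0 l0 : R) (T : \bar R) (b p u : R -> R).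
Hypothesis l0_gt0 : 0 < l0.
Hypothesis T_gt0 : (0 < T)%E.
Hypothesis red : reduced_flow T b p u.
Hypothesis max : reduced_maximal T b p u.
Hypothesis b_init : b 0 = r0 * l0.
Hypothesis p_init : p 0 = (r0 + 2) * l0.
Hypothesis u_init : u 0 = 2 * k0 * l0.
Hypothesis g_neq0 : 1 + r0 - 2 * r0 ^+ 2 - k0 ^+ 2 != 0.

Local Notation I := (time_interval T).
Local Notation l t := (2^-1 * (p t - b t)).
Local Notation r t := (b t / l t).
Local Notation k t := (u t / (2 * l t)).
Local Notation g t := (1 + r t - 2 * r t ^+ 2 - k t ^+ 2).
Local Notation m0 := (k0 / (r0 + 2)).

Let E := p 0 ^+ 2 - u 0 ^+ 2.
Let q := E - 9 * b 0 ^+ 2.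

(* These identities turn the conditions on [r0] and [k0] into signs of [E] and
   [q]. *)
Let EE : E = l0 ^+ 2 * ((r0 + 2) ^+ 2 - 4 * k0 ^+ 2).
Proof. by rewrite /E p_init u_init; ring. Qed.

Let qE : q = 4 * l0 ^+ 2 * (1 + r0 - 2 * r0 ^+ 2 - k0 ^+ 2).
Proof. by rewrite /q EE b_init; ring. Qed.

Let l02 : 0 < l0 ^+ 2. Proof. exact: exprn_gt0. Qed.

Let q_neq0 : q != 0.
Proof. by rewrite qE !mulf_neq0// ?pnatr_eq0// gt_eqF. Qed.

Let amplitude : exists y v, amplitude_flow T E q y v /\ forall t, I t ->
  [/\ p t = p 0 * y t ^+ 2, u t = u 0 * y t ^+ 2 & b t = v t / y t].
Proof. exact: reduced_flow_amplitude. Qed.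

Let escape y v : amplitude_flow T E q y v -> (forall t, I t ->
    [/\ p t = p 0 * y t ^+ 2, u t = u 0 * y t ^+ 2 & b t = v t / y t]) ->
  escaping T y.
Proof.
move=> amp rep T1 TE t2 e M; move: (red) (max) amp rep; rewrite TE.
exact: amplitude_unbounded.
Qed.

Let v_init y v : amplitude_flow T E q y v -> (forall t, I t ->
    [/\ p t = p 0 * y t ^+ 2, u t = u 0 * y t ^+ 2 & b t = v t / y t]) ->
  v 0 = r0 * l0.
Proof.
move=> amp rep; have [_ _] := rep 0 (time_interval0 T_gt0).
by rewrite (amplitude_init amp) divr1 => <-.
Qed.

Let end_time : (T < +oo)%E -> \forall t \near (fine T)^'-, I t.
Proof.
case: T T_gt0 => [T1||]//; rewrite lte_fin => T10 _.
by move: (near_time_interval_end (lexx 0) T10); apply: filterS => t [].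
Qed.

(** The hypotheses say that [p 0] and [E] are positive, and that [v 0] is positive in case
    [q] is negative. *)
Lemma growth_regime : 0 < r0 + 2 -> 4 * k0 ^+ 2 < (r0 + 2) ^+ 2 ->
  (1 + r0 - 2 * r0 ^+ 2 < k0 ^+ 2 -> 0 < r0) ->
  (T < +oo)%E /\
  [/\ r t @[t --> (fine T)^'-] --> r_infty m0,
      k t @[t --> (fine T)^'-] --> k_infty m0,
      g t @[t --> (fine T)^'-] --> 0
    & l t @[t --> (fine T)^'-] --> +oo].
Proof.
move=> r02 k0r r0gt0.
have [y [v [amp rep]]] := amplitude.
have E0 : 0 < E by rewrite EE mulr_gt0// subr_gt0.
have [|Tfin yoo Xlim] := amplitude_growth amp (escape amp rep) E0 q_neq0.
  rewrite qE pmulr_rlt0 ?mulr_gt0// subr_lt0 => /r0gt0 r0pos.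
  by rewrite (v_init amp rep) mulr_gt0.
split=> //.
have p00 : 0 < p 0 by rewrite p_init mulr_gt0.
have r2neq0 : r0 + 2 != 0 by rewrite gt_eqF.
have u0E : u 0 = 2 * m0 * p 0 by rewrite u_init p_init; field.
have Em : E = p 0 ^+ 2 * (1 - 4 * m0 ^+ 2) by rewrite /E u0E; ring.
have m0E : 0 <= 1 - 4 * m0 ^+ 2.
  by rewrite -(pmulr_rge0 _ (exprn_gt0 2 p00)) -Em ltW.
pose s := Num.sqrt (1 - 4 * m0 ^+ 2).
have s0 : 0 <= s by exact: sqrtr_ge0.
have s2 : s ^+ 2 = 1 - 4 * m0 ^+ 2 by rewrite sqr_sqrtr.
have sE : Num.sqrt E = p 0 * s.
  by rewrite Em sqrtrM ?sqr_ge0// sqrtr_sqr gtr0_norm.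
have s1 : s <= 1.
  by rewrite -(ler_pXn2r (ltn0Sn 1))// ?nnegrE// expr1n s2; have := sqr_ge0 m0; lra.
rewrite sE in Xlim.
have xp : p 0 * s / 3 < p 0.
  have : p 0 * s <= p 0 * 1 by rewrite ler_pM2l.
  by lra.
have near_rep : \forall t \near (fine T)^'-, [/\ 0 < y t, p t = p 0 * y t ^+ 2,
    u t = u 0 * y t ^+ 2 & b t = v t / y t].
  move: (end_time Tfin); apply: filterS => t It.
  by have [pt ut bt] := rep t It; split=> //; exact: (amplitude_gt0 amp).
have [rlim klim llim] := growth_limits near_rep xp yoo Xlim.
have [rE kE gE] := infty_values s0 s2 erefl (lt0r_neq0 p00).
rewrite rE in rlim; rewrite u0E kE in klim.
split=> //; rewrite -gE !expr2.
by apply: cvgB; [apply: cvgB; [apply: cvgD; [exact: cvg_cst|]|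
  apply: cvgM; [exact: cvg_cst|exact: cvgM]]|exact: cvgM].
Qed.

(** The hypotheses say that [q] is negative, and that [v 0] is negative in case
    [E] is not. *)
Lemma collapse_regime : 1 + r0 - 2 * r0 ^+ 2 < k0 ^+ 2 ->
  (4 * k0 ^+ 2 <= (r0 + 2) ^+ 2 -> r0 < 0) ->
  (T < +oo)%E /\
  [/\ r t @[t --> (fine T)^'-] --> (- 2 : R),
      k t @[t --> (fine T)^'-] --> 0
    & l t @[t --> (fine T)^'-] --> +oo].
Proof.
move=> g0 r0lt0; have [y [v [amp rep]]] := amplitude.
have q0 : q < 0 by rewrite qE pmulr_rlt0 ?mulr_gt0// subr_lt0.
have [|Tfin [c [c0 vc ylim]]] := amplitude_collapse amp (escape amp rep) q0.
  rewrite EE pmulr_rge0// subr_ge0 => /r0lt0 r0neg.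
  by rewrite (v_init amp rep) nmulr_rlt0.
split=> //; apply: (collapse_limits (p0 := p 0) (u0 := u 0) _ c0 vc ylim).
move: (end_time Tfin); apply: filterS => t It.
by have [pt ut bt] := rep t It; split=> //; exact: (amplitude_gt0 amp).
Qed.

(** The affine amplitude gives a solution on the whole half-line, which forces the
    maximal time to be infinite; on this half-line [y] tends to infinity while
    [v] is constant. *)
Lemma borderline_regime : 0 < r0 -> k0 ^+ 2 = 4^-1 * (r0 + 2) ^+ 2 ->
  T = +oo%E /\
  [/\ r t @[t --> +oo] --> 0, k t @[t --> +oo] --> Num.sg k0,
      g t @[t --> +oo] --> 0 & l t @[t --> +oo] --> +oo].
Proof.
move=> r00 k0E; have [y [v [amp rep]]] := amplitude.
have b00 : 0 < b 0 by rewrite b_init mulr_gt0.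
have E0 : E = 0 by rewrite EE k0E; field.
have pu : p 0 ^+ 2 = u 0 ^+ 2 by apply/eqP; rewrite -subr_eq0 -/E E0.
have TE : T = +oo%E.
  apply/eqP; rewrite eq_le leey /=.
  apply: (max _ (affine_reduced_flow (ltW b00) pu)) => //.
  - by rewrite mulr0 addr0 divr1.
  - by rewrite mulr0 addr0 expr1n mulr1.
  - by rewrite mulr0 addr0 expr1n mulr1.
split=> //.
have It t : 0 <= t -> I t by move=> t0; split=> //; rewrite TE ltry.
have v0 : v 0 = b 0 by rewrite (v_init amp rep).
have vE t : 0 <= t -> v t = b 0.
  move=> t0; rewrite -v0; apply/esym/(is_derive_0_eq t0) => s /andP[s0 _].
  by have := amplitude_v amp (It s s0); rewrite E0 mulr0 mul0r.
have yge t : 0 <= t -> 1 + 2^-1 * b 0 * (t - 0) <= y t.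
  move=> t0; rewrite -[X in X + _](amplitude_init amp); apply: (is_derive_ge_growth t0).
    by move=> s /andP[s0 _]; exact: (amplitude_y amp (It s s0)).
  by move=> s /andP[s0 _]; rewrite (vE _ (ltW s0)).
have near_ge (B : R) : \forall t \near +oo, B <= t.
  by apply: nbhs_pinfty_ge; exact: num_real.
have pos := near_ge 0.
have yoo : y t @[t --> +oo] --> +oo.
  apply/cvgryPge => A; move: pos (near_ge (2 * `|A| / b 0)).
  apply: filterS2 => t t0 At; apply: le_trans (yge t t0); rewrite subr0.
  by move: At; rewrite ler_pdivrMr//; have := ler_norm A; lra.
have Xlim : v t / y t ^+ 3 @[t --> +oo] --> (0 : R).
  rewrite -(mulr0 (b 0)) -[X in b 0 * X](expr0n R 3).
  apply: (@cvg_trans _ (b 0 * (y t)^-1 ^+ 3 @[t --> +oo])).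
    by apply: near_eq_cvg; move: pos; apply: filterS => t t0; rewrite vE// exprVn.
  apply: cvgM; first exact: cvg_cst.
  have yV : (y t)^-1 @[t --> +oo] --> 0.
    apply/gtr0_cvgV0 => //; move: pos; apply: filterS => t t0.
    exact: (amplitude_gt0 amp (It t t0)).
  exact: (cvg_comp _ _ yV (@exprn_continuous R 3 0)).
have near_rep : \forall t \near +oo, [/\ 0 < y t, p t = p 0 * y t ^+ 2,
    u t = u 0 * y t ^+ 2 & b t = v t / y t].
  move: pos; apply: filterS => t /It tI.
  by have [pt ut bt] := rep t tI; split=> //; exact: (amplitude_gt0 amp).
have p00 : 0 < p 0 by rewrite p_init mulr_gt0// addr_gt0.
have [rlim klim llim] := growth_limits near_rep p00 yoo Xlim.
have kE : u 0 / p 0 = Num.sg k0.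
  rewrite u_init p_init.
  have : `|k0| = (r0 + 2) / 2.
    have := real_normK (num_real k0); rewrite k0E => k0E'.
    apply/eqP; rewrite -(eqrXn2 (ltn0Sn 1)) ?normr_ge0 ?divr_ge0 ?addr_ge0 ?(ltW r00)//.
    by rewrite k0E'; apply/eqP; field.
  move=> kn; have -> : k0 = Num.sg k0 * ((r0 + 2) / 2) by rewrite -kn -numEsg.
  rewrite sgrM (gtr0_sg (_ : 0 < (r0 + 2) / 2)) ?divr_gt0 ?addr_gt0// mulr1 sgr_id.
  by field; rewrite !gt_eqF// addr_gt0.
rewrite mulr0 subr0 mul0r in rlim; rewrite subr0 kE in klim.
split=> //.
have -> : (0 : R) = 1 + 0 - 2 * (0 * 0) - Num.sg k0 * Num.sg k0.
  have : Num.sg k0 ^+ 2 = 1.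
    have kpos : 0 < k0 ^+ 2 by rewrite k0E mulr_gt0 ?invr_gt0// exprn_gt0// addr_gt0.
    by rewrite sqr_sg -(sqrf_eq0 k0) gt_eqF.
  by rewrite expr2; lra.
rewrite [X in X @ _](_ : _ = fun t => 1 + r t - 2 * (r t * r t) - k t * k t)//.
by apply: cvgB; [apply: cvgB; [apply: cvgD; [exact: cvg_cst|]|
  apply: cvgM; [exact: cvg_cst|exact: cvgM]]|exact: cvgM].
Qed.

End Regimes.

Theorem theorem2p4 (R : realType) (l0 r0 k0 : R)
  (Tmax : \bar R) (S : R -> 'M[R]_3) (w : R -> 'cV[R]_3)
  (l0_gt0 : 0 < l0)
  (k0_neq : k0 ^+ 2 <> 1 + r0 - 2 * r0 ^+ 2)
  (Sw_max : sv_maximal_solution Tmax S w)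
  (S_init : S 0 = strain_of r0 l0)
  (w_init : w 0 = vorticity_of k0 l0) :
  let I := time_interval Tmax in
  (forall (T' : \bar R) (S' : R -> 'M[R]_3) (w' : R -> 'cV[R]_3),
     sv_solution T' S' w' ->
     S' 0 = strain_of r0 l0 -> w' 0 = vorticity_of k0 l0 ->
     (T' <= Tmax)%E /\
     forall t, time_interval T' t -> S' t = S t /\ w' t = w t) /\
  exists r k l : R -> R,
    [/\ C1_in I r, C1_in I k
      & C1_in I l] /\
    [/\ r 0 = r0, k 0 = k0 & l 0 = l0] /\
    (forall t, I t -> S t = strain_of (r t) (l t)) /\
    (forall t, I t -> w t = vorticity_of (k t) (l t)) /\
    (forall t, I t -> deriv_in I l t =
       3^-1 * (- 1 + 2 * r t + 2 * r t ^+ 2 + k t ^+ 2) * l t ^+ 2) /\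
    (forall t, I t -> deriv_in I r t =
       3^-1 * l t * (2 + 3 * r t - 3 * r t ^+ 2 - 2 * r t ^+ 3
                     - (r t + 2) * k t ^+ 2)) /\
    (forall t, I t -> deriv_in I k t =
       3^-1 * l t * (1 + r t - 2 * r t ^+ 2 - k t ^+ 2) * k t) /\
    let m0 := k0 / (r0 + 2) in
    let g := fun t : R => 1 + r t - 2 * r t ^+ 2 - k t ^+ 2 in
    let T := fine Tmax in
    (0 < r0 -> 1 + r0 - 2 * r0 ^+ 2 < k0 ^+ 2 ->
       k0 ^+ 2 < 4^-1 * (r0 + 2) ^+ 2 ->
       (Tmax < +oo)%E /\
       [/\ r t @[t --> T^'-] --> r_infty m0,
           k t @[t --> T^'-] --> k_infty m0,
           g t @[t --> T^'-] --> 0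
         & l t @[t --> T^'-] --> +oo]) /\
    (- 2^-1 < r0 -> r0 < 1 -> k0 ^+ 2 < 1 + r0 - 2 * r0 ^+ 2 ->
       (Tmax < +oo)%E /\
       [/\ r t @[t --> T^'-] --> r_infty m0,
           k t @[t --> T^'-] --> k_infty m0,
           g t @[t --> T^'-] --> 0
         & l t @[t --> T^'-] --> +oo]) /\
    (* k has the sign of k0: its limit is 1 if k0 > 0 and -1 if k0 < 0 *)
    (0 < r0 -> k0 ^+ 2 = 4^-1 * (r0 + 2) ^+ 2 ->
       Tmax = +oo%E /\
       [/\ r t @[t --> +oo] --> 0,
           k t @[t --> +oo] --> Num.sg k0,
           g t @[t --> +oo] --> 0
         & l t @[t --> +oo] --> +oo]) /\
    (0 < r0 -> 4^-1 * (r0 + 2) ^+ 2 < k0 ^+ 2 ->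
       (Tmax < +oo)%E /\
       [/\ r t @[t --> T^'-] --> (- 2 : R),
           k t @[t --> T^'-] --> 0
         & l t @[t --> T^'-] --> +oo]) /\
    (- 2^-1 <= r0 -> r0 <= 0 -> 1 + r0 - 2 * r0 ^+ 2 < k0 ^+ 2 ->
       (Tmax < +oo)%E /\
       [/\ r t @[t --> T^'-] --> (- 2 : R),
           k t @[t --> T^'-] --> 0
         & l t @[t --> T^'-] --> +oo]) /\
    (r0 < - 2^-1 ->
       (Tmax < +oo)%E /\
       [/\ r t @[t --> T^'-] --> (- 2 : R),
           k t @[t --> T^'-] --> 0
         & l t @[t --> T^'-] --> +oo]).
Proof.
move=> I.
have sol : sv_solution Tmax S w by case: Sw_max.
have T0 : (0 < Tmax)%E := sv_T_gt0 sol.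
split.
  move=> T' S' w' sol' S'0 w'0.
  by apply: sv_maximal_unique Sw_max sol' _ _; rewrite ?S'0 ?w'0.
have S_red : S 0 = reduced_strain (r0 * l0) ((r0 + 2) * l0).
  by rewrite S_init strain_of_reduced.
have [b [p [u [red [[b0 p0 u0] SwE]]]]] := sv_solution_reduced sol S_red w_init.
have max : reduced_maximal Tmax b p u.
  move=> T' b' p' u' T'0 red' b'0 p'0 u'0.
  have sol' := reduced_flow_sv_solution T'0 red'.
  have [SE wE] := SwE 0 (time_interval0 T0).
  by apply: (proj1 (sv_maximal_unique Sw_max sol' _ _)); rewrite ?SE ?wE ?b'0 ?p'0 ?u'0.
pose l t := 2^-1 * (p t - b t).
have l_init : l 0 = l0 by rewrite /l b0 p0; field.
have lgt0 t : time_interval Tmax t -> 0 < l t.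
  by apply: reduced_flow_eigenvalue_gt0 red _ _; rewrite -/(l 0) l_init.
have [C1 [lE rE kE]] := shape_C1 red lgt0.
have g_neq0 : 1 + r0 - 2 * r0 ^+ 2 - k0 ^+ 2 != 0.
  by rewrite subr_eq0 eq_sym; apply/eqP.
exists (fun t => b t / l t), (fun t => u t / (2 * l t)), l.
split; first exact: C1.
split.
  rewrite l_init b0 u0; split=> //; first by rewrite mulfK// gt_eqF.
  by field; rewrite gt_eqF.
split.
  move=> t It; rewrite (SwE t It).1 strain_of_reduced.
  have lt0 : l t != 0 by rewrite gt_eqF// lgt0.
  by congr reduced_strain; rewrite ?mulrDl mulfVK// /l; field.
split.
  move=> t It; rewrite (SwE t It).2 vorticity_of_reduced.
  have lt0 : l t != 0 by rewrite gt_eqF// lgt0.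
  by congr reduced_vorticity; field.
do 3 (split; first by []).
have growth := growth_regime l0_gt0 T0 red max b0 p0 u0 g_neq0.
have collapse := collapse_regime l0_gt0 T0 red max b0 p0 u0 g_neq0.
split; [|split; [|split; [|split; [|split]]]].
- move=> r00 g0 kr; apply: growth => //; lra.
- move=> r01 r02 g0; apply: growth; [lra | | lra].
  by have := sqr_ge0 r0; rewrite sqrrD; lra.
- exact: borderline_regime l0_gt0 T0 red max b0 p0 u0 g_neq0.
- move=> r00 kr; apply: collapse; last by lra.
  by apply: lt_trans kr; have := exprn_gt0 2 r00; rewrite sqrrD; lra.
- move=> r01 r02 g0; apply: collapse => // kr.
  rewrite lt_neqAle r02 andbT; apply/eqP => r00; rewrite r00 in kr g0.
  by lra.
- move=> r01; apply: collapse; last by lra.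
  apply: lt_le_trans (sqr_ge0 k0).
  have -> : 1 + r0 - 2 * r0 ^+ 2 = - ((1 - r0) * (- 1 - 2 * r0)) by ring.
  by rewrite oppr_lt0 mulr_gt0//; lra.
Qed.
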